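(* Let $\mathcal{C}$ be a triangulated category that has all small coproducts and satisfies the following Brown representability property: every cohomological functor $\mathcal{C}^{op}\to \mathrm{Ab}$ that converts small coproducts in $\mathcal{C}$ into products of abelian groups is representable by an object of $\mathcal{C}$. Let $w$ be a weight structure on $\mathcal{C}$. Then there exists a $t$-structure $t$ on $\mathcal{C}$ that is right adjacent to $w$ if and only if $w$ is smashing. Moreover, if such a $t$ exists, then the heart of $t$ is equivalent to the category of all those additive functors $\underline{Hw}^{op}\to \mathrm{Ab}$ that respect products (i.e., that convert coproducts in $\underline{Hw}$ into products of abelian groups), where $\underline{Hw}$ is the heart of $w$.
   Context: Weight structures: a weight structure $w$ on a triangulated category $\mathcal{C}$ is a pair of classes $(\mathcal{C}_{w\le 0},\mathcal{C}_{w\ge 0})$ of objects of $\mathcal{C}$ such that: (i) both classes are closed under retracts in $\mathcal{C}$; (ii) $\mathcal{C}_{w\le 0}\subset \mathcal{C}_{w\le 0}[1]$ and $\mathcal{C}_{w\ge 0}[1]\subset \mathcal{C}_{w\ge 0}$; (iii) $\mathcal{C}(X,Y)=0$ for all $X\in\mathcal{C}_{w\le 0}$, $Y\in \mathcal{C}_{w\ge 0}[1]$; (iv) every object $M$ of $\mathcal{C}$ fits in a distinguished triangle $LM\to M\to RM\to LM[1]$ with $LM\in\mathcal{C}_{w\le 0}$, $RM\in \mathcal{C}_{w\ge 0}[1]$. The heart $\underline{Hw}$ is the full subcategory of $\mathcal{C}$ with object class $\mathcal{C}_{w\le 0}\cap\mathcal{C}_{w\ge 0}$. $w$ is smashing if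 $\mathcal{C}$ has coproducts and $\mathcal{C}_{w\ge 0}$ is closed under small $\mathcal{C}$-coproducts. $t$-structures $t=(\mathcal{C}^{t\le 0},\mathcal{C}^{t\ge 0})$ are in the usual cohomological convention ($\mathcal{C}^{t\le 0}[1]\subset\mathcal{C}^{t\le 0}$), with both classes closed under isomorphisms. $t$ is right adjacent to $w$ if $\mathcal{C}^{t\le 0}=\mathcal{C}_{w\ge 0}$. *)

(* Defs.v *)
From HB Require Import structures.
From mathcomp Require Import all_boot all_algebra.
From mathcomp Require Import boolp.

Set Implicit Arguments.
Unset Strict Implicit.
Unset Printing Implicit Defensive.

Import GRing.Theory.
Local Open Scope ring_scope.

(* "Small" means: in the universe of the carriers of abelian groups, hence of
   the hom-groups of a preadditive category.  The objects of a category may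
   form a larger type. *)
Notation smallType := (Type@{Algebra.Zmodule.axioms_.u0}).

Reserved Notation "g \oc f" (at level 50, left associativity).

Record category := Category {
  ob :> Type;
  hom : ob -> ob -> Type;
  idm : forall X, hom X X;
  comp : forall X Y Z, hom Y Z -> hom X Y -> hom X Z;
  comp_idl : forall X Y (f : hom X Y), comp (idm Y) f = f;
  comp_idr : forall X Y (f : hom X Y), comp f (idm X) = f;
  comp_assoc : forall X Y Z T (h : hom Z T) (g : hom Y Z) (f : hom X Y),
    comp h (comp g f) = comp (comp h g) f
}.
Arguments hom {c} X Y.
Arguments idm {c} X.
Arguments comp {c X Y Z} g f.
Notation "g \oc f" := (comp g f).

Definition opcat (C : category) : category :=
  @Category C (fun X Y => hom Y X) (fun X => idm X)
    (fun X Y Z g f => f \oc g)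
    (fun X Y f => comp_idr f) (fun X Y f => comp_idl f)
    (fun X Y Z T h g f => esym (comp_assoc f g h)).

Definition isomorphic (C : category) (X Y : C) : Prop :=
  exists (f : hom X Y) (g : hom Y X), g \oc f = idm X /\ f \oc g = idm Y.

Definition is_retract (C : category) (Y X : C) : Prop :=
  exists (i : hom Y X) (p : hom X Y), p \oc i = idm Y.

Definition is_coproduct (C : category) (I : smallType) (X : I -> C) (S : C)
    (inj : forall i, hom (X i) S) : Prop :=
  forall (T : C) (f : forall i, hom (X i) T),
    exists! g : hom S T, forall i, g \oc inj i = f i.

Definition is_product (C : category) (I : smallType) (X : I -> C) (P : C)
    (proj : forall i, hom P (X i)) : Prop :=
  forall (T : C) (f : forall i, hom T (X i)),
    exists! g : hom T P, forall i, proj i \oc g = f i.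

Definition has_coproducts (C : category) : Prop :=
  forall (I : smallType) (X : I -> C),
    exists (S : C) (inj : forall i, hom (X i) S), is_coproduct inj.

Record functor (C D : category) := Functor {
  fob :> C -> D;
  fmap : forall X Y : C, hom X Y -> hom (fob X) (fob Y);
  fmap_id : forall X : C, fmap (idm X) = idm (fob X);
  fmap_comp : forall (X Y Z : C) (g : hom Y Z) (f : hom X Y),
    fmap (g \oc f) = fmap g \oc fmap f
}.
Arguments fmap {C D} F {X Y} f : rename.

Definition functor_id (C : category) : functor C C :=
  @Functor C C (fun X => X) (fun X Y f => f)
    (fun X => erefl) (fun X Y Z g f => erefl).

Lemma functor_comp_id (C D E : category) (G : functor D E) (F : functor C D)
  (X : C) : fmap G (fmap F (idm X)) = idm (G (F X)).
Proof. by rewrite !fmap_id. Qed.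

Lemma functor_comp_comp (C D E : category) (G : functor D E) (F : functor C D)
  (X Y Z : C) (g : hom Y Z) (f : hom X Y) :
  fmap G (fmap F (g \oc f)) = fmap G (fmap F g) \oc fmap G (fmap F f).
Proof. by rewrite !fmap_comp. Qed.

Definition functor_comp (C D E : category) (G : functor D E) (F : functor C D) :
    functor C E :=
  @Functor C E (fun X => G (F X)) (fun X Y f => fmap G (fmap F f))
    (functor_comp_id G F) (functor_comp_comp G F).

Record nattrans (C D : category) (F G : functor C D) := NatTrans {
  ntmap :> forall X : C, hom (F X) (G X);
  nt_natural : forall (X Y : C) (f : hom X Y),
    ntmap Y \oc fmap F f = fmap G f \oc ntmap X
}.

Lemma nattransP (C D : category) (F G : functor C D) (a b : nattrans F G) :
  (forall X, a X = b X) -> a = b.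
Proof.
case: a b => [a na] [b nb] /= ab.
have {}ab : a = b by apply: functional_extensionality_dep.
by subst b; congr NatTrans; apply: Prop_irrelevance.
Qed.

Definition nt_id (C D : category) (F : functor C D) : nattrans F F.
Proof.
by exists (fun X => idm (F X)) => X Y f; rewrite comp_idl comp_idr.
Defined.

Definition nt_comp (C D : category) (F G H : functor C D)
  (b : nattrans G H) (a : nattrans F G) : nattrans F H.
Proof.
exists (fun X => b X \oc a X) => X Y f.
by rewrite -comp_assoc nt_natural comp_assoc nt_natural comp_assoc.
Defined.

Definition functor_cat (C D : category) : category.
Proof.
apply: (@Category (functor C D) (@nattrans C D) (@nt_id C D) (@nt_comp C D)).
- by move=> F G a; apply: nattransP => X; apply: comp_idl.
- by move=> F G a; apply: nattransP => X; apply: comp_idr.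
- by move=> F G H K c b a; apply: nattransP => X; apply: comp_assoc.
Defined.

Definition is_equivalence (C D : category) (F : functor C D) : Prop :=
  exists G : functor D C,
    @isomorphic (functor_cat C C) (functor_comp G F) (functor_id C) /\
    @isomorphic (functor_cat D D) (functor_comp F G) (functor_id D).

Definition equivalent (C D : category) : Prop :=
  exists F : functor C D, is_equivalence F.

Definition full_subcat (C : category) (P : C -> Prop) : category :=
  @Category {X : C | P X} (fun X Y => hom (sval X) (sval Y))
    (fun X => idm (sval X)) (fun X Y Z g f => g \oc f)
    (fun X Y f => comp_idl f) (fun X Y f => comp_idr f)
    (fun X Y Z T h g f => comp_assoc h g f).

Lemma additiveP (A B : zmodType) (f g : {additive A -> B}) : f =1 g -> f = g.
Proof.
case: f g => [f [[nf]]] [g [[ng]]] /= fg.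
have {}fg : f = g by apply: functional_extensionality_dep.
by subst g; rewrite (Prop_irrelevance nf ng).
Qed.

Definition Ab : category.
Proof.
apply: (@Category zmodType (fun A B => {additive A -> B})
  (fun A => idfun) (fun A B C g f => g \o f)).
- by move=> A B f; apply: additiveP.
- by move=> A B f; apply: additiveP.
- by move=> A B C D h g f; apply: additiveP.
Defined.

Record preadditive := Preadditive {
  pob : Type;
  phom : pob -> pob -> zmodType;
  pidm : forall X, phom X X;
  pcomp : forall X Y Z, phom Y Z -> phom X Y -> phom X Z;
  pcomp_idl : forall X Y (f : phom X Y), pcomp (pidm Y) f = f;
  pcomp_idr : forall X Y (f : phom X Y), pcomp f (pidm X) = f;
  pcomp_assoc : forall X Y Z T (h : phom Z T) (g : phom Y Z) (f : phom X Y),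
    pcomp h (pcomp g f) = pcomp (pcomp h g) f;
  pcompDl : forall X Y Z (g g' : phom Y Z) (f : phom X Y),
    pcomp (g + g') f = pcomp g f + pcomp g' f;
  pcompDr : forall X Y Z (g : phom Y Z) (f f' : phom X Y),
    pcomp g (f + f') = pcomp g f + pcomp g f'
}.

Definition underlying_category (C : preadditive) : category :=
  @Category (pob C) (fun X Y => phom X Y) (@pidm C) (@pcomp C)
    (@pcomp_idl C) (@pcomp_idr C) (@pcomp_assoc C).
Coercion underlying_category : preadditive >-> category.


Definition full_presubcat (C : preadditive) (P : C -> Prop) : preadditive :=
  @Preadditive {X : C | P X} (fun X Y => phom (sval X) (sval Y))
    (fun X => pidm (sval X)) (fun X Y Z g f => pcomp g f)
    (fun X Y f => pcomp_idl f) (fun X Y f => pcomp_idr f)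
    (fun X Y Z T h g f => pcomp_assoc h g f)
    (fun X Y Z g g' f => pcompDl g g' f)
    (fun X Y Z g f f' => pcompDr g f f').

Definition is_zero (C : preadditive) (Z : C) : Prop :=
  forall X : C, (forall f : hom X Z, f = 0) /\ (forall f : hom Z X, f = 0).

Definition is_biproduct (C : preadditive) (X Y S : C) : Prop :=
  exists (i : hom X S) (j : hom Y S) (p : hom S X) (q : hom S Y),
    [/\ p \oc i = idm X, q \oc j = idm Y, p \oc j = 0, q \oc i = 0 &
        (i \oc p) + (j \oc q) = idm S].

Definition is_additive (C : preadditive) : Prop :=
  (exists Z : C, is_zero Z) /\ forall X Y : C, exists S, is_biproduct X Y S.

Definition additive_functor (C D : preadditive) (F : functor C D) : Prop :=
  forall (X Y : C) (f g : hom X Y), fmap F (f + g) = fmap F f + fmap F g.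

Definition ab_map (A B : Ab) (f : hom A B) : {additive A -> B} := f.

Definition additive_presheaf (C : preadditive) (F : functor (opcat C) Ab) :
    Prop :=
  forall (X Y : C) (f g : hom X Y) (y : F Y),
    ab_map (fmap F (f + g)) y = ab_map (fmap F f) y + ab_map (fmap F g) y.

Definition respects_products (C : category) (F : functor (opcat C) Ab) : Prop :=
  forall (I : smallType) (X : I -> C) (S : C) (inj : forall i, hom (X i) S),
    is_coproduct inj ->
    @is_product Ab I (fun i => F (X i)) (F S) (fun i => fmap F (inj i)).

Definition precomp (C : preadditive) (M X Y : C) (f : hom X Y)
  (g : phom Y M) : phom X M := pcomp g f.

Lemma precomp_nmod_morphism (C : preadditive) (M X Y : C) (f : hom X Y) :
  nmod_morphism (@precomp C M X Y f).
Proof.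
split=> [|g g']; last exact: pcompDl.
by apply: (addIr (precomp f (0 : phom Y M))); rewrite -pcompDl !add0r.
Qed.

HB.instance Definition _ (C : preadditive) (M X Y : C) (f : hom X Y) :=
  GRing.isNmodMorphism.Build (phom Y M) (phom X M) (precomp f)
    (@precomp_nmod_morphism C M X Y f).

Definition representable_presheaf (C : preadditive) (M : C) :
  functor (opcat C) Ab.
Proof.
apply: (@Functor (opcat C) Ab (fun X : C => phom X M)
  (fun X Y (f : phom Y X) => (precomp f : {additive phom X M -> phom Y M}))).
- by move=> X; apply: additiveP => g; apply: pcomp_idr.
- by move=> X Y Z g f; apply: additiveP => h; apply: pcomp_assoc.
Defined.

Definition representable (C : preadditive) (H : functor (opcat C) Ab) : Prop :=
  exists M : C,
    @isomorphic (functor_cat (opcat C) Ab) H (representable_presheaf M).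

(* The shift [1] is an additive autoequivalence, not required to be strictly
   invertible; accordingly all closure conditions on classes of objects below
   are stated up to isomorphism. *)
Record triangulated := Triangulated {
  tcat :> preadditive;
  tr_additive : is_additive tcat;
  shift : functor tcat tcat;
  shift_additive : additive_functor shift;
  shift_equivalence : is_equivalence shift;
  distinguished : forall X Y Z : tcat,
    hom X Y -> hom Y Z -> hom Z (shift X) -> Prop;
  dist_iso : forall (X Y Z X' Y' Z' : tcat)
      (f : hom X Y) (g : hom Y Z) (h : hom Z (shift X))
      (f' : hom X' Y') (g' : hom Y' Z') (h' : hom Z' (shift X'))
      (a : hom X X') (b : hom Y Y') (c : hom Z Z')
      (a' : hom X' X) (b' : hom Y' Y) (c' : hom Z' Z),
    a' \oc a = idm X -> a \oc a' = idm X' ->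
    b' \oc b = idm Y -> b \oc b' = idm Y' ->
    c' \oc c = idm Z -> c \oc c' = idm Z' ->
    b \oc f = f' \oc a -> c \oc g = g' \oc b -> fmap shift a \oc h = h' \oc c ->
    distinguished f g h -> distinguished f' g' h';
  dist_id : forall X Z : tcat, is_zero Z ->
    distinguished (idm X) (0 : hom X Z) (0 : hom Z (shift X));
  dist_cone : forall (X Y : tcat) (f : hom X Y),
    exists (Z : tcat) (g : hom Y Z) (h : hom Z (shift X)), distinguished f g h;
  dist_rotate : forall (X Y Z : tcat)
      (f : hom X Y) (g : hom Y Z) (h : hom Z (shift X)),
    distinguished f g h <-> distinguished g h (- fmap shift f);
  dist_morphism : forall (X Y Z X' Y' Z' : tcat)
      (f : hom X Y) (g : hom Y Z) (h : hom Z (shift X))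
      (f' : hom X' Y') (g' : hom Y' Z') (h' : hom Z' (shift X'))
      (a : hom X X') (b : hom Y Y'),
    distinguished f g h -> distinguished f' g' h' -> b \oc f = f' \oc a ->
    exists c : hom Z Z', c \oc g = g' \oc b /\ fmap shift a \oc h = h' \oc c;
  dist_octahedron : forall (X Y Z A B D : tcat) (f : hom X Y) (g : hom Y Z)
      (f1 : hom Y A) (f2 : hom A (shift X))
      (g1 : hom Z B) (g2 : hom B (shift Y))
      (h1 : hom Z D) (h2 : hom D (shift X)),
    distinguished f f1 f2 -> distinguished g g1 g2 ->
    distinguished (g \oc f) h1 h2 ->
    exists (u : hom A D) (v : hom D B),
      [/\ distinguished u v (fmap shift f1 \oc g2),
          u \oc f1 = h1 \oc g, h2 \oc u = f2, v \oc h1 = g1 &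
          g2 \oc v = fmap shift f \oc h2]
}.
Arguments shift {t}.
Arguments distinguished {t X Y Z} f g h.

Section Classes.
Variable C : triangulated.
Implicit Types P Q : C -> Prop.

Definition subclass P Q : Prop := forall X, P X -> Q X.

(* shifted P is P[1], unshifted P is P[-1]. *)
Definition shifted P : C -> Prop :=
  fun X => exists2 Y, P Y & isomorphic X (shift Y).

Definition unshifted P : C -> Prop :=
  fun X => exists2 Y, P Y & isomorphic (shift X) Y.

Definition orthogonal P Q : Prop :=
  forall X Y, P X -> Q Y -> forall f : hom X Y, f = 0.

Definition retract_closed P : Prop :=
  forall X Y : C, is_retract Y X -> P X -> P Y.

Definition iso_closed P : Prop :=
  forall X Y : C, isomorphic X Y -> P X -> P Y.

Definition has_decompositions P Q : Prop :=
  forall M : C, exists (L R : C)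
    (f : hom L M) (g : hom M R) (h : hom R (shift L)),
    [/\ distinguished f g h, P L & Q R].

Definition coproduct_closed P : Prop :=
  forall (I : smallType) (X : I -> C) (S : C) (inj : forall i, hom (X i) S),
    is_coproduct inj -> (forall i, P (X i)) -> P S.

End Classes.

Record weight_structure (C : triangulated) := WeightStructure {
  w_le : C -> Prop;
  w_ge : C -> Prop;
  w_le_retract : retract_closed w_le;
  w_ge_retract : retract_closed w_ge;
  w_le_shift : subclass w_le (shifted w_le);
  w_ge_shift : subclass (shifted w_ge) w_ge;
  w_orthogonal : orthogonal w_le (shifted w_ge);
  w_decomposition : has_decompositions w_le (shifted w_ge)
}.

Definition w_heart (C : triangulated) (w : weight_structure C) : preadditive :=
  full_presubcat (fun X : C => w_le w X /\ w_ge w X).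

Definition smashing (C : triangulated) (w : weight_structure C) : Prop :=
  has_coproducts C /\ coproduct_closed (w_ge w).

Record t_structure (C : triangulated) := TStructure {
  t_le : C -> Prop;
  t_ge : C -> Prop;
  t_le_iso : iso_closed t_le;
  t_ge_iso : iso_closed t_ge;
  t_le_shift : subclass (shifted t_le) t_le;
  t_ge_shift : subclass t_ge (shifted t_ge);
  t_orthogonal : orthogonal t_le (unshifted t_ge);
  t_decomposition : has_decompositions t_le (unshifted t_ge)
}.

Definition t_heart (C : triangulated) (t : t_structure C) : preadditive :=
  full_presubcat (fun X : C => t_le t X /\ t_ge t X).

Definition right_adjacent (C : triangulated)
    (t : t_structure C) (w : weight_structure C) : Prop :=
  forall X : C, t_le t X <-> w_ge w X.

Definition cohomological (C : triangulated) (H : functor (opcat C) Ab) : Prop :=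
  additive_presheaf H /\
  forall (X Y Z : C) (f : hom X Y) (g : hom Y Z) (h : hom Z (shift X)),
    distinguished f g h ->
    forall y : H Y, ab_map (fmap H f) y = 0 <->
      exists z : H Z, ab_map (fmap H g) z = y.

Definition brown_representability (C : triangulated) : Prop :=
  forall H : functor (opcat C) Ab,
    cohomological H -> respects_products H -> representable H.

Definition product_respecting_presheaves (C : preadditive) : category :=
  @full_subcat (functor_cat (opcat C) Ab)
    (fun F => additive_presheaf F /\ respects_products F).

(* Main.v *)
(* Write w_{>=0} for the right class of w.  When w is smashing, an additive
   presheaf G on w_{>=0} which is exact on triangles inside w_{>=0} and turns
   coproducts into products is representable by an object of w_{>=0}: choosing
   weak reflections X -> B_X into w_{>=0}, the left Kan extension of G to C is
   the quotient of G(B_X) by the elements k^* psi with k : B_X -> E, E in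
   w_{>=0}, that vanish on X.  It is cohomological and respects products,
   because w_{>=0} is closed under cones and coproducts, so Brown
   representability applies; it kills the objects orthogonal to w_{>=0}, so the
   representing object lies in w_{>=0}.

   For G = C(-, M) this gives the coreflection of M into w_{>=0}, and
   Wakamatsu's argument shows that its cone is right orthogonal to w_{>=0}: this
   is the t-structure.  For a presheaf F on the heart of w, take
   G(B) = Nat(C(-, B), F), natural transformations over the heart.  Every B in
   w_{>=0} sits in a triangle K -> A -> B -> K[1] with A in the heart and K in
   w_{>=0}, and A covers B as seen from the heart; so G(B) is the subgroup of
   F(A) of elements killed by the relations of A -> B.  The object representing
   G lies in the heart of t and restricts to F; the same presentations, applied
   to objects of the heart of t, show that restriction to the heart of w is
   fully faithful. *)

From HB Require Import structures.
From mathcomp Require Import all_boot all_algebra ring_quotient.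
From mathcomp Require Import boolp.
Require Import Defs.

Set Implicit Arguments.
Unset Strict Implicit.
Unset Printing Implicit Defensive.

Import GRing.Theory.
Local Open Scope ring_scope.

(** * Groups, categories and additive presheaves *)

Section SubgroupsAndQuotients.
Local Open Scope quotient_scope.
Variables (V : zmodType) (P : V -> Prop).
Hypotheses (P0 : P 0) (PB : forall x y, P x -> P y -> P (x - y)).

Definition subgroup_pred : {pred V} := [pred x | `[< P x >]].

Lemma subgroup_predP x : reflect (P x) (x \in subgroup_pred).
Proof. exact: asboolP. Qed.

Lemma subgroup_zmod_closed : zmod_closed subgroup_pred.
Proof.
split=> [|x y /subgroup_predP Px /subgroup_predP Py]; apply/subgroup_predP.
  by [].
exact: PB.
Qed.

HB.instance Definition _ := GRing.isZmodClosed.Build V subgroup_pred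
  subgroup_zmod_closed.

Record subgroup_type := Subgroup { sgval : V; _ : sgval \in subgroup_pred }.

HB.instance Definition _ := [isSub for sgval].
HB.instance Definition _ := [Choice of subgroup_type by <:].
HB.instance Definition _ := [SubChoice_isSubZmodule of subgroup_type by <:].

Lemma subgroup_exists : exists (K : zmodType) (i : {additive K -> V}),
  injective i /\ forall x, P x <-> exists y, i y = x.
Proof.
exists subgroup_type, (val : {additive subgroup_type -> V}); split.
  exact: val_inj.
move=> x; split=> [/subgroup_predP Px|[[y /subgroup_predP Py] <-]] //.
by exists (Subgroup Px).
Qed.

Lemma quotient_exists : exists (Q : zmodType) (p : {additive V -> Q}),
  (forall z, exists x, p x = z) /\ forall x, p x = 0 <-> P x.
Proof.
pose Q := Quotient.quot subgroup_pred.
have pi_nmod : nmod_morphism (\pi_Q : V -> Q).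
  by split=> [|x y]; rewrite !piE.
pose p := GRing.isNmodMorphism.Build V Q (\pi_Q) pi_nmod.
pose pA : {additive V -> Q} := HB.pack (\pi_Q : V -> Q) p.
exists Q, pA; split=> [z|x].
  by exists (repr z); rewrite /= reprK.
have eq0 : (\pi_Q x == 0 :> Q) = (x \in subgroup_pred).
  by rewrite -[x in RHS]subr0 Quotient.idealrBE !piE.
split=> [/eqP|/subgroup_predP Px]; first by rewrite eq0 => /subgroup_predP.
by apply/eqP; rewrite eq0.
Qed.

End SubgroupsAndQuotients.

Lemma dependent_choice (X : Type) (T : X -> Type) (P : forall x, T x -> Prop) :
  (forall x, exists y, P x y) -> exists f : forall x, T x, forall x, P x (f x).
Proof.
by move=> h; exists (fun x => projT1 (cid (h x))) => x; case: cid.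
Qed.

Section Equivalences.
Variables (C D : category) (F : functor C D).

Definition faithful : Prop :=
  forall (X Y : C) (f g : hom X Y), fmap F f = fmap F g -> f = g.

Definition full : Prop :=
  forall (X Y : C) (k : hom (F X) (F Y)), exists f : hom X Y, fmap F f = k.

Definition ess_surj : Prop := forall Y : D, exists X : C, isomorphic (F X) Y.

End Equivalences.

Lemma iso_id_faithful (C : category) (H : functor C C) :
  @isomorphic (functor_cat C C) H (functor_id C) -> faithful H.
Proof.
case=> [a [b [ba ab]]] X Y f g Hfg.
have a1 Z : a Z \oc b Z = idm Z := congr1 (fun n : nattrans _ _ => n Z) ab.
have nat_a (k : hom X Y) : k = a Y \oc fmap H k \oc b X.
  have /= -> := nt_natural a k.
  by rewrite -comp_assoc a1 comp_idr.
by rewrite (nat_a f) (nat_a g) Hfg.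
Qed.

Lemma equivalence_fully_faithful (C D : category) (F : functor C D) :
  is_equivalence F -> [/\ faithful F, full F & ess_surj F].
Proof.
case=> G [GF FG].
have fGF := iso_id_faithful GF; have fFG := iso_id_faithful FG.
have Ffaith : faithful F by move=> X Y f g fg; apply: fGF; rewrite /= fg.
have Gfaith : faithful G by move=> X Y f g fg; apply: fFG; rewrite /= fg.
split=> //.
  case: GF => [a [b [ba ab]]] X Y k.
  have a1 Z : a Z \oc b Z = idm Z := congr1 (fun n : nattrans _ _ => n Z) ab.
  have b1 Z : b Z \oc a Z = idm (G (F Z)) :=
    congr1 (fun n : nattrans _ _ => n Z) ba.
  exists (a Y \oc fmap G k \oc b X); apply: Gfaith.
  have /= nab := nt_natural b (a Y \oc fmap G k \oc b X).
  rewrite -[LHS]comp_idr -(b1 X) comp_assoc -nab.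
  by rewrite !comp_assoc b1 comp_idl -!comp_assoc b1 comp_idr.
case: FG => [a [b [ba ab]]] Y.
exists (G Y), (a Y), (b Y); split.
  exact: (congr1 (fun n : nattrans _ _ => n Y) ba).
exact: (congr1 (fun n : nattrans _ _ => n Y) ab).
Qed.

Lemma fully_faithful_equivalence (C D : category) (F : functor C D) :
  faithful F -> full F -> ess_surj F -> is_equivalence F.
Proof.
move=> Ffaith Ffull Fsurj.
pose g0 Y : C := sval (cid (Fsurj Y)).
have /dependent_choice[e /dependent_choice[e' ee']] :
    forall Y, exists (e : hom (F (g0 Y)) Y), exists e' : hom Y (F (g0 Y)),
      e' \oc e = idm _ /\ e \oc e' = idm _.
  by move=> Y; rewrite /g0; case: cid.
have e'e Y : e' Y \oc e Y = idm _ by case: (ee' Y).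
have {}ee' Y : e Y \oc e' Y = idm _ by case: (ee' Y).
pose pre X Y (k : hom (F X) (F Y)) := sval (cid (Ffull X Y k)).
have preK X Y k : fmap F (@pre X Y k) = k by rewrite /pre; case: cid.
pose g1 X Y (f : hom X Y) : hom (g0 X) (g0 Y) := pre _ _ (e' Y \oc f \oc e X).
have g1id X : g1 _ _ (idm X) = idm (g0 X).
  by apply: Ffaith; rewrite /g1 preK comp_idr e'e fmap_id.
have g1c X Y Z (g : hom Y Z) (f : hom X Y) :
    g1 _ _ (g \oc f) = g1 _ _ g \oc g1 _ _ f.
  apply: Ffaith; rewrite fmap_comp /g1 !preK -!comp_assoc (comp_assoc (e Y)).
  by rewrite ee' comp_idl.
pose G := Functor g1id g1c.
exists G; split.
  have na X Y (f : hom X Y) :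
      pre _ _ (e (F Y)) \oc fmap (functor_comp G F) f
      = f \oc pre _ _ (e (F X)).
    apply: Ffaith; rewrite !fmap_comp !preK /= /g1 ?preK.
    by rewrite !comp_assoc ee' comp_idl.
  have nb X Y (f : hom X Y) :
      pre _ _ (e' (F Y)) \oc f
      = fmap (functor_comp G F) f \oc pre _ _ (e' (F X)).
    apply: Ffaith; rewrite !fmap_comp !preK /= /g1 ?preK.
    by rewrite -!comp_assoc ee' comp_idr.
  exists (@NatTrans C C (functor_comp G F) (functor_id C)
            (fun X => pre _ _ (e (F X))) na).
  exists (@NatTrans C C (functor_id C) (functor_comp G F)
            (fun X => pre _ _ (e' (F X))) nb).
  split; apply: nattransP => X; apply: Ffaith.
    by rewrite /= fmap_comp !preK e'e fmap_id.
  by rewrite /= fmap_comp !preK ee' fmap_id.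
have na X Y (f : hom X Y) : e Y \oc fmap (functor_comp F G) f = f \oc e X.
  by rewrite /= /g1 preK !comp_assoc ee' comp_idl.
have nb X Y (f : hom X Y) : e' Y \oc f = fmap (functor_comp F G) f \oc e' X.
  by rewrite /= /g1 preK -!comp_assoc ee' comp_idr.
exists (@NatTrans D D (functor_comp F G) (functor_id D) e na).
exists (@NatTrans D D (functor_id D) (functor_comp F G) e' nb).
by split; apply: nattransP => X; rewrite /= ?e'e ?ee'.
Qed.

Section Preadditive.
Variable C : preadditive.
Implicit Types X Y Z : C.

Lemma compDl X Y Z (g g' : hom Y Z) (f : hom X Y) :
  (g + g' : hom Y Z) \oc f = (g \oc f) + (g' \oc f).
Proof. exact: pcompDl. Qed.

Lemma compDr X Y Z (g : hom Y Z) (f f' : hom X Y) :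
  g \oc (f + f' : hom X Y) = (g \oc f) + (g \oc f').
Proof. exact: pcompDr. Qed.

Lemma comp0l X Y Z (f : hom X Y) : (0 : hom Y Z) \oc f = 0.
Proof. by apply: (addrI ((0 : hom Y Z) \oc f)); rewrite -compDl !addr0. Qed.

Lemma comp0r X Y Z (g : hom Y Z) : g \oc (0 : hom X Y) = 0.
Proof. by apply: (addrI (g \oc (0 : hom X Y))); rewrite -compDr !addr0. Qed.

Lemma compNl X Y Z (g : hom Y Z) (f : hom X Y) :
  (- g : hom Y Z) \oc f = - (g \oc f).
Proof. by apply: (addIr (g \oc f)); rewrite -compDl !addNr comp0l. Qed.

Lemma compNr X Y Z (g : hom Y Z) (f : hom X Y) :
  g \oc (- f : hom X Y) = - (g \oc f).
Proof. by apply: (addIr (g \oc f)); rewrite -compDr !addNr comp0r. Qed.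

Lemma compBl X Y Z (g g' : hom Y Z) (f : hom X Y) :
  (g - g' : hom Y Z) \oc f = (g \oc f) - (g' \oc f).
Proof. by rewrite compDl compNl. Qed.

Lemma compBr X Y Z (g : hom Y Z) (f f' : hom X Y) :
  g \oc (f - f' : hom X Y) = (g \oc f) - (g \oc f').
Proof. by rewrite compDr compNr. Qed.

End Preadditive.

Definition act (C : category) (F : functor (opcat C) Ab) (X Y : C)
  (f : hom X Y) : {additive F Y -> F X} := ab_map (fmap F f).

Lemma act_id (C : category) (F : functor (opcat C) Ab) (X : C) (x : F X) :
  act F (idm X) x = x.
Proof. by rewrite /act (fmap_id F (X : opcat C)). Qed.

Lemma act_comp (C : category) (F : functor (opcat C) Ab) (X Y Z : C)
    (g : hom Y Z) (f : hom X Y) (z : F Z) :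
  act F (g \oc f) z = act F f (act F g z).
Proof.
by rewrite /act (@fmap_comp (opcat C) Ab F Z Y X f g).
Qed.

Section AdditivePresheaves.
Variables (C : preadditive) (F : functor (opcat C) Ab).
Hypothesis Fadd : additive_presheaf F.

Lemma actD (X Y : C) (f g : hom X Y) (y : F Y) :
  act F (f + g) y = act F f y + act F g y.
Proof. exact: Fadd. Qed.

Lemma act0 (X Y : C) (y : F Y) : act F (0 : hom X Y) y = 0.
Proof. by apply: (addrI (act F (0 : hom X Y) y)); rewrite -actD !addr0. Qed.

Lemma actN (X Y : C) (f : hom X Y) (y : F Y) : act F (- f) y = - act F f y.
Proof. by apply: (addIr (act F f y)); rewrite -actD !addNr act0. Qed.

Lemma actB (X Y : C) (f g : hom X Y) (y : F Y) :
  act F (f - g) y = act F f y - act F g y.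
Proof. by rewrite actD actN. Qed.

End AdditivePresheaves.

Definition universal_element (C : category) (F : functor (opcat C) Ab) (L : C)
  (x : F L) : Prop :=
  forall (X : C) (y : F X), exists! f : hom X L, act F f x = y.

Lemma representable_universal (C : preadditive) (F : functor (opcat C) Ab) :
  representable F -> exists (L : C) (x : F L), universal_element x.
Proof.
case=> L [a [b [ba ab]]].
have a1 (X : C) (f : phom X L) : ab_map (a X) (ab_map (b X) f) = f.
  have /(congr1 (fun h : {additive phom X L -> phom X L} => h f)) :=
    congr1 (fun n : @nattrans (opcat C) Ab _ (representable_presheaf L) => n X)
      ab.
  by [].
have b1 (X : C) (x : F X) : ab_map (b X) (ab_map (a X) x) = x.
  have /(congr1 (fun h : {additive F X -> F X} => h x)) :=
    congr1 (fun n : @nattrans (opcat C) Ab F F => n X) ba.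
  by [].
have bact (X : C) (f : hom X L) :
    ab_map (b X) f = act F f (ab_map (b L) (idm L)).
  have /(congr1 (fun h : {additive phom L L -> F X} => h (idm L))) :=
    nt_natural b (f : @hom (opcat C) L X).
  move=> /= <-; congr (ab_map (b X) _).
  by rewrite /= /precomp (pcomp_idl f).
exists L, (ab_map (b L) (idm L)) => X y; exists (ab_map (a X) y); split.
  by rewrite -bact b1.
by move=> f' <-; rewrite -bact a1.
Qed.

Section Coproducts.
Variable C : category.

Lemma coproduct_ext (I : smallType) (X : I -> C) (S : C)
    (inj : forall i, hom (X i) S) (T : C) (g g' : hom S T) :
  is_coproduct inj -> (forall i, g \oc inj i = g' \oc inj i) -> g = g'.
Proof.
move=> cS gg'; have [h [_ uh]] := cS T (fun i => g \oc inj i).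
by rewrite -(uh g) // -(uh g').
Qed.

Lemma coproduct_desc (I : smallType) (X : I -> C) (S : C)
    (inj : forall i, hom (X i) S) (T : C) (f : forall i, hom (X i) T) :
  is_coproduct inj -> exists g : hom S T, forall i, g \oc inj i = f i.
Proof. by move=> cS; have [g [gf _]] := cS T f; exists g. Qed.

Lemma equivalence_coproduct (D : category) (F : functor C D) (I : smallType)
    (X : I -> C) (S : C) (inj : forall i, hom (X i) S) :
  is_equivalence F -> is_coproduct inj ->
  is_coproduct (fun i => fmap F (inj i)).
Proof.
move=> /equivalence_fully_faithful[Ffaith Ffull Fsurj] cS T f.
have [T0 [e [e' [e'e ee']]]] := Fsurj T.
have /dependent_choice[f0 f0E] :
    forall i, exists f0 : hom (X i) T0, fmap F f0 = e' \oc f i.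
  by move=> i; apply: Ffull.
have [g gf] := coproduct_desc f0 cS.
exists (e \oc fmap F g); split=> [i|h hf].
  by rewrite -comp_assoc -fmap_comp gf f0E comp_assoc ee' comp_idl.
have [h0 h0E] := Ffull _ _ (e' \oc h).
have -> : h = e \oc fmap F h0 by rewrite h0E comp_assoc ee' comp_idl.
congr (_ \oc fmap F _); apply: (coproduct_ext cS) => i.
by rewrite gf; apply: Ffaith; rewrite f0E fmap_comp h0E -comp_assoc hf.
Qed.

End Coproducts.

Section SubcategoryCoproducts.
Variables (C : preadditive) (P : C -> Prop) (I : smallType).
Variables (X : I -> full_presubcat P) (S : full_presubcat P).
Variable inj : forall i, @hom (full_presubcat P) (X i) S.

Lemma coproduct_to_subcat :
  @is_coproduct C I (fun i => sval (X i)) (sval S) inj ->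
  @is_coproduct (full_presubcat P) I X S inj.
Proof. by move=> cS T f; apply: (cS (sval T) f). Qed.

Lemma coproduct_of_subcat (S' : C) (inj' : forall i, hom (sval (X i)) S') :
  is_coproduct inj' -> P S' -> @is_coproduct (full_presubcat P) I X S inj ->
  @is_coproduct C I (fun i => sval (X i)) (sval S) inj.
Proof.
move=> cS' PS' cS.
have [u uE] :=
  coproduct_desc (inj : forall i, @hom C (sval (X i)) (sval S)) cS'.
pose S1 : full_presubcat P := exist _ S' PS'.
have [v vE] : exists v : hom (sval S) S', forall i, v \oc inj i = inj' i.
  exact: (@coproduct_desc (full_presubcat P) I X S inj S1 inj' cS).
have uv : u \oc v = idm (sval S).
  apply: (@coproduct_ext (full_presubcat P) I X S inj S
            (u \oc v) (idm (sval S)) cS) => i.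
  rewrite -[LHS](@comp_assoc C).
  have := congr1 (comp u) (vE i); rewrite uE => ->.
  by rewrite [RHS](@comp_idl C).
move=> T f; have [g gE] := coproduct_desc f cS'.
exists (g \oc v); split=> [i|h hE].
  by rewrite -comp_assoc vE gE.
rewrite -[h]comp_idr -uv comp_assoc; congr (_ \oc _).
by apply: (coproduct_ext cS') => i; rewrite gE -comp_assoc uE hE.
Qed.

End SubcategoryCoproducts.

(** * Triangles and weight structures *)

Section Triangles.
Variable C : triangulated.
Implicit Types X Y Z T : C.

Lemma shift_faithful : faithful (@shift C).
Proof. by case: (equivalence_fully_faithful (shift_equivalence C)). Qed.

Lemma shift_full : full (@shift C).
Proof. by case: (equivalence_fully_faithful (shift_equivalence C)). Qed.

Lemma shift_ess_surj : ess_surj (@shift C).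
Proof. by case: (equivalence_fully_faithful (shift_equivalence C)). Qed.

Lemma shift0 X Y : fmap shift (0 : hom X Y) = 0.
Proof.
apply: (addrI (fmap shift (0 : hom X Y))).
by rewrite -shift_additive !addr0.
Qed.

Lemma shift_eq0 X Y (f : hom X Y) : fmap shift f = 0 -> f = 0.
Proof. by move=> f0; apply: shift_faithful; rewrite f0 shift0. Qed.

Lemma is_zero_idm (Z : C) : idm Z = 0 -> is_zero Z.
Proof.
move=> Z0 X; split=> f; first by rewrite -[f]comp_idl Z0 comp0l.
by rewrite -[f]comp_idr Z0 comp0r.
Qed.

Lemma zero_exists : exists Z : C, is_zero Z.
Proof. by case: (tr_additive C). Qed.

Lemma dist_rot X Y Z (f : hom X Y) (g : hom Y Z) (h : hom Z (shift X)) :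
  distinguished f g h -> distinguished g h (- fmap shift f).
Proof. by case: (dist_rotate f g h). Qed.

Section OneTriangle.
Variables (X Y Z : C) (f : hom X Y) (g : hom Y Z) (h : hom Z (shift X)).
Hypothesis fgh : distinguished f g h.

Lemma dist_comp0 : g \oc f = 0.
Proof.
have [O O0] := zero_exists.
have [c [<- _]] := @dist_morphism C _ _ _ _ _ _ _ _ _ _ _ _ (idm X) f
  (dist_id X O0) fgh erefl.
exact: comp0r.
Qed.

Lemma dist_weak_kernel T (u : hom T Y) : g \oc u = 0 ->
  exists v : hom T X, u = f \oc v.
Proof.
move=> gu0; have [O O0] := zero_exists.
have d1 := dist_rot (dist_id T O0).
have d2 := dist_rot fgh.
have sq : (0 : hom O Z) \oc (0 : hom T O) = g \oc u by rewrite comp0l gu0.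
have [c [_]] := dist_morphism d1 d2 sq.
rewrite fmap_id compNr comp_idr compNl => /oppr_inj.
have [v <-] := shift_full c; rewrite -fmap_comp => uv.
by exists v; apply: shift_faithful.
Qed.

Lemma dist_weak_cokernel T (u : hom Y T) : u \oc f = 0 ->
  exists v : hom Z T, u = v \oc g.
Proof.
move=> uf0; have [O O0] := zero_exists.
have sO0 : is_zero (shift O).
  by apply: is_zero_idm; rewrite -fmap_id ((O0 O).1 (idm O)) shift0.
have d : distinguished (0 : hom O T) (idm T) (0 : hom T (shift O)).
  by apply/dist_rotate; rewrite shift0 oppr0; apply: dist_id.
have sq : u \oc f = (0 : hom O T) \oc (0 : hom X O) by rewrite comp0l uf0.
have [c [cg _]] := dist_morphism fgh d sq.
by exists c; rewrite cg comp_idl.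
Qed.

End OneTriangle.

(* This replaces the fact that coproducts of triangles are triangles: the map
   from [SY] to the cone of [F] factors through [G], since it does so on each
   summand. *)
Lemma coproduct_weak_kernel (I : smallType) (X Y Z : I -> C)
    (f : forall i, hom (X i) (Y i)) (g : forall i, hom (Y i) (Z i))
    (SX SY SZ : C) (iX : forall i, hom (X i) SX) (iY : forall i, hom (Y i) SY)
    (iZ : forall i, hom (Z i) SZ) (F : hom SX SY) (G : hom SY SZ) :
  is_coproduct iX -> is_coproduct iY -> is_coproduct iZ ->
  (forall i (T : C) (u : hom (Y i) T), u \oc f i = 0 ->
     exists v : hom (Z i) T, u = v \oc g i) ->
  (forall i, F \oc iX i = iY i \oc f i) ->
  (forall i, G \oc iY i = iZ i \oc g i) ->
  forall (Q : C) (r : hom Q SY), G \oc r = 0 ->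
    exists s : hom Q SX, r = F \oc s.
Proof.
move=> cX cY cZ wc FE GE Q r Gr0.
have [W [d [e FdeD]]] := dist_cone F.
have /dependent_choice[v vE] :
    forall i, exists v : hom (Z i) W, d \oc iY i = v \oc g i.
  move=> i; apply: wc.
  by rewrite -comp_assoc -FE comp_assoc (dist_comp0 FdeD) comp0l.
have [V VE] := coproduct_desc v cZ.
have dE : d = V \oc G.
  by apply: (coproduct_ext cY) => i; rewrite -comp_assoc GE comp_assoc VE vE.
by apply: (dist_weak_kernel FdeD); rewrite dE -comp_assoc Gr0 comp0r.
Qed.

End Triangles.

Section WeightStructures.
Variables (C : triangulated) (w : weight_structure C).
Implicit Types A B E K X Y Z : C.

Lemma iso_retract (D : category) (X Y : D) : isomorphic X Y -> is_retract Y X.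
Proof. by case=> f [g [gf fg]]; exists g, f. Qed.

Lemma iso_sym (D : category) (X Y : D) : isomorphic X Y -> isomorphic Y X.
Proof. by case=> f [g [gf fg]]; exists g, f. Qed.

Lemma shifted_shift (P : C -> Prop) E : P E -> shifted P (shift E).
Proof.
by move=> PE; exists E => //; exists (idm _), (idm _); rewrite comp_idl.
Qed.

Lemma w_ge_shift1 E : w_ge w E -> w_ge w (shift E).
Proof. by move=> /(@shifted_shift _ E) /w_ge_shift. Qed.

Lemma w_le_ge_eq0 A E (f : hom A (shift E)) : w_le w A -> w_ge w E -> f = 0.
Proof. by move=> wA wE; apply: (w_orthogonal wA (shifted_shift wE)). Qed.

Lemma shift_w_le_ge_eq0 A E (f : hom A E) :
  w_le w (shift A) -> w_ge w E -> f = 0.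
Proof. by move=> wA wE; apply: shift_eq0; apply: w_le_ge_eq0. Qed.

Lemma weight_triangle X : exists A K (k : hom K A) (a : hom A X)
  (d : hom X (shift K)), [/\ distinguished k a d, w_le w A & w_ge w K].
Proof.
have [A [R [a [g [h [agh wA [K wK [u [v [vu uv]]]]]]]]]] := w_decomposition w X.
have [k kE] := shift_full (- (h \oc v)).
exists A, K, k, a, (u \oc g); split=> //; apply/dist_rotate.
apply: (dist_iso (a := idm A) (b := idm X) (c := u) (a' := idm A)
  (b' := idm X) (c' := v) _ _ _ _ vu uv _ _ _ agh); rewrite ?comp_idl //.
- by rewrite comp_idr.
- by rewrite comp_idr.
- by rewrite fmap_id comp_idl kE opprK -comp_assoc vu comp_idr.
Qed.

Lemma weak_reflection X : exists B (eta : hom X B), w_ge w B /\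
  forall E (p : hom X E), w_ge w E -> exists q : hom B E, p = q \oc eta.
Proof.
have [A [B [k [a [d [kad wA wB]]]]]] := weight_triangle (shift X).
have [eta etaE] := shift_full d.
exists B, eta; split=> // E p wE.
have [|q pq] := dist_weak_cokernel (dist_rot kad) (u := fmap shift p).
  exact: w_le_ge_eq0.
by have [q0 q0E] := shift_full q; exists q0; apply: shift_faithful;
  rewrite pq fmap_comp q0E etaE.
Qed.

Lemma w_ge_orthogonal E :
  (forall A (f : hom A E), w_le w (shift A) -> f = 0) -> w_ge w E.
Proof.
move=> orthE; have [A [B [k [a [d [kad wA wB]]]]]] := weight_triangle (shift E).
have a0 : a = 0.
  have [A' [u [v [vu uv]]]] := shift_ess_surj A.
  have wA' : w_le w (shift A').
    by apply: w_le_retract wA; apply: iso_retract; exists v, u.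
  have [a' a'E] := shift_full (a \oc u).
  by rewrite -[a]comp_idr -uv comp_assoc -a'E (orthE _ a') // shift0 comp0l.
have [|v vd] := dist_weak_cokernel (dist_rot kad)
  (u := idm (shift E)); first by rewrite comp_idl.
have [v' v'E] := shift_full v; have [d' d'E] := shift_full d.
apply: w_ge_retract wB; exists d', v'; apply: shift_faithful.
by rewrite fmap_comp v'E d'E -vd fmap_id.
Qed.

Lemma w_le_orthogonal A :
  (forall E (f : hom A (shift E)), w_ge w E -> f = 0) -> w_le w A.
Proof.
move=> orthA; have [A' [K [k [a [d [kad wA' wK]]]]]] := weight_triangle A.
have [|v av] := dist_weak_kernel (dist_rot kad) (u := idm A).
  by rewrite comp_idr; apply: orthA.
by apply: w_le_retract wA'; exists v, a.
Qed.

Lemma w_ge_extension X Y Z (f : hom X Y) (g : hom Y Z) (h : hom Z (shift X)) :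
  distinguished f g h -> w_ge w X -> w_ge w Z -> w_ge w Y.
Proof.
move=> fgh wX wZ; apply: w_ge_orthogonal => A u wA.
have [|v ->] := dist_weak_kernel fgh (u := u).
  exact: shift_w_le_ge_eq0.
by rewrite (shift_w_le_ge_eq0 v) ?comp0r.
Qed.

Lemma w_ge_cone X Y Z (f : hom X Y) (g : hom Y Z) (h : hom Z (shift X)) :
  distinguished f g h -> w_ge w X -> w_ge w Y -> w_ge w Z.
Proof.
move=> /dist_rotate ghf wX wY; apply: w_ge_extension ghf wY _.
exact: w_ge_shift1.
Qed.

Lemma w_ge_biproduct X Y S : is_biproduct X Y S ->
  w_ge w X -> w_ge w Y -> w_ge w S.
Proof.
move=> [i [j [p [q [_ _ _ _ ipjq]]]]] wX wY.
apply: w_ge_orthogonal => A u wA.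
rewrite -[u]comp_idl -ipjq compDl -!comp_assoc.
by rewrite (shift_w_le_ge_eq0 (p \oc u)) // (shift_w_le_ge_eq0 (q \oc u)) //
  !comp0r addr0.
Qed.

Lemma w_le_coproduct : coproduct_closed (w_le w).
Proof.
move=> I X S inj cS wX; apply: w_le_orthogonal => E f wE.
apply: (coproduct_ext cS) => i.
by rewrite (w_le_ge_eq0 (f \oc inj i)) // comp0l.
Qed.

End WeightStructures.

(** * Brown representability for the right class of a weight structure *)

Section AbelianProducts.
Variables (I : smallType) (A : I -> zmodType) (P : zmodType).
Variable pr : forall i, {additive P -> A i}.

Lemma ab_product :
  (forall x, (forall i, pr i x = 0) -> x = 0) ->
  (forall a : forall i, A i, exists x, forall i, pr i x = a i) ->
  @is_product Ab I A P pr.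
Proof.
move=> pinj psurj T f.
have injP x y : (forall i, pr i x = pr i y) -> x = y.
  move=> xy; apply/eqP; rewrite -subr_eq0; apply/eqP/pinj => i.
  by rewrite raddfB xy subrr.
have /dependent_choice[g gE] : forall t : T, exists x : P,
  forall i, pr i x = ab_map (f i) t by move=> t; apply: psurj.
have g_nmod : nmod_morphism g.
  split=> [|x y]; apply: injP => i; first by rewrite gE !raddf0.
  by rewrite raddfD !gE raddfD.
pose gA : {additive T -> P} :=
  HB.pack (g : T -> P) (GRing.isNmodMorphism.Build T P g g_nmod).
exists gA; split=> [i|h hE]; first by apply: additiveP => t; apply: gE.
apply: additiveP => t; apply: injP => i; rewrite /= gE.
by rewrite -(hE i).
Qed.

Lemma mulrz_nmod (V : zmodType) (x : V) : nmod_morphism (intmul x).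
Proof. by split=> [|m n]; rewrite ?mulr0z ?mulrzDr. Qed.

Hypothesis prodP : @is_product Ab I A P pr.

(* Elements of [V] are additive maps [int -> V]. *)
Lemma ab_product_surj (a : forall i, A i) : exists x, forall i, pr i x = a i.
Proof.
pose f i : {additive int -> A i} := HB.pack (intmul (a i))
  (GRing.isNmodMorphism.Build int (A i) (intmul (a i)) (mulrz_nmod (a i))).
have [g [gf _]] := prodP f.
exists (ab_map g 1%Z) => i.
have /(congr1 (fun h : {additive int -> A i} => h 1%Z)) := gf i.
by rewrite /= mulr1z.
Qed.

Lemma ab_product_inj x y : (forall i, pr i x = pr i y) -> x = y.
Proof.
move=> xy.
pose f (z : P) : {additive int -> P} := HB.pack (intmul z)
  (GRing.isNmodMorphism.Build int P (intmul z) (mulrz_nmod z)).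
have [g [_ gu]] := prodP (fun i => comp (c := Ab) (pr i) (f x)).
have gx := gu (f x) (fun=> erefl).
have gy : g = f y.
  apply: gu => i; apply: additiveP => n /=.
  by rewrite !raddfMz xy.
have /(congr1 (fun h : {additive int -> P} => h 1%Z)) : f x = f y :=
  etrans (esym gx) gy.
by rewrite /= !mulr1z.
Qed.

End AbelianProducts.

Notation wge_cat w := (full_presubcat (w_ge w)).

Section KanExtension.
Variables (C : triangulated) (w : weight_structure C).
Variable G : functor (opcat (wge_cat w)) Ab.
Hypothesis Gadd : additive_presheaf G.

Variable B : C -> wge_cat w.
Variable eta : forall X : C, hom X (sval (B X)).
Variable lift : forall (X : C) (E : wge_cat w),
  hom X (sval E) -> @hom (wge_cat w) (B X) E.
Hypothesis liftP : forall X E (p : hom X (sval E)),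
  @comp C _ _ _ (lift p) (eta X) = p.

Definition negligible (X : C) (phi : G (B X)) : Prop :=
  exists (E : wge_cat w) (k : @hom (wge_cat w) (B X) E) (psi : G E),
    @comp C _ _ _ k (eta X) = 0 /\ phi = act G k psi.

Lemma negligible0 X : negligible (0 : G (B X)).
Proof. by exists (B X), 0, 0; rewrite comp0l raddf0. Qed.

Lemma negligibleB X (x y : G (B X)) :
  negligible x -> negligible y -> negligible (x - y).
Proof.
move=> [E [k [f [k0 ->]]]] [E' [k' [f' [k0' ->]]]].
have [S bS] := (tr_additive C).2 (sval E) (sval E').
have wS := w_ge_biproduct bS (svalP E) (svalP E').
have [i [j [p [q [pi1 qj pj qi _]]]]] := bS.
pose S1 : wge_cat w := exist _ S wS.
pose K : @hom (wge_cat w) (B X) S1 := @comp C _ _ _ i k + @comp C _ _ _ j k'.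
pose p1 : @hom (wge_cat w) S1 E := p.
pose q1 : @hom (wge_cat w) S1 E' := q.
exists S1, K, (act G p1 f - act G q1 f'); split.
  by rewrite compDl -!comp_assoc k0 k0' !comp0r addr0.
have pK : p1 \oc K = k.
  have := compDr p (i \oc (k : hom (sval (B X)) (sval E)))
            (j \oc (k' : hom (sval (B X)) (sval E'))).
  by rewrite !comp_assoc pi1 pj comp0l addr0 comp_idl.
have qK : q1 \oc K = k'.
  have := compDr q (i \oc (k : hom (sval (B X)) (sval E)))
            (j \oc (k' : hom (sval (B X)) (sval E'))).
  by rewrite !comp_assoc qj qi comp0l add0r comp_idl.
by rewrite raddfB /= -!act_comp pK qK.
Qed.

Variable Q : C -> zmodType.
Variable pi : forall X, {additive G (B X) -> Q X}.
Hypothesis pi_surj : forall X z, exists x, pi X x = z.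
Hypothesis pi_ker : forall X x, pi X x = 0 <-> negligible x.

Definition cl (X : C) (E : wge_cat w) (p : hom X (sval E)) (phi : G E) : Q X :=
  pi X (act G (lift p) phi).

Lemma clE X E (p : hom X (sval E)) (q : @hom (wge_cat w) (B X) E) (phi : G E) :
  @comp C _ _ _ q (eta X) = p -> cl p phi = pi X (act G q phi).
Proof.
move=> qp; apply/eqP; rewrite -subr_eq0 -raddfB -actB //; apply/eqP/pi_ker.
exists E, (lift p - q), phi; split=> //.
by rewrite compBl liftP qp subrr.
Qed.

Lemma cl_eta X (phi : G (B X)) : cl (eta X) phi = pi X phi.
Proof. by rewrite (@clE _ _ _ (idm (B X))) ?act_id // comp_idl. Qed.

Lemma cl_comp X (E E' : wge_cat w) (k : @hom (wge_cat w) E E')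
  (p : hom X (sval E)) (phi : G E') :
  cl (@comp C _ _ _ k p) phi = cl p (act G k phi).
Proof.
rewrite (@clE _ _ _ (k \oc lift p)) ?act_comp //.
by rewrite -[LHS]comp_assoc liftP.
Qed.

Lemma cl0p X (E : wge_cat w) (phi : G E) : cl (0 : hom X (sval E)) phi = 0.
Proof. by rewrite (@clE _ _ _ 0) ?comp0l // act0 // raddf0. Qed.

Lemma clDp X (E : wge_cat w) (p q : hom X (sval E)) (phi : G E) :
  cl (p + q : hom X (sval E)) phi = cl p phi + cl q phi.
Proof.
rewrite (@clE _ _ _ (lift p + lift q)) ?actD ?raddfD //.
by rewrite compDl !liftP.
Qed.

Lemma clB X (E : wge_cat w) (p : hom X (sval E)) (phi psi : G E) :
  cl p (phi - psi) = cl p phi - cl p psi.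
Proof. by rewrite /cl !raddfB. Qed.

Lemma clD X (E : wge_cat w) (p : hom X (sval E)) (phi psi : G E) :
  cl p (phi + psi) = cl p phi + cl p psi.
Proof. by rewrite /cl !raddfD. Qed.

Definition repr_of X (z : Q X) : G (B X) := projT1 (cid (pi_surj z)).

Lemma repr_ofK X (z : Q X) : pi X (repr_of z) = z.
Proof. by rewrite /repr_of; case: cid. Qed.

Definition pullback (X Y : C) (f : hom X Y) (z : Q Y) : Q X :=
  cl (eta Y \oc f) (repr_of z).

Lemma pullback_cl X Y (f : hom X Y) (E : wge_cat w) (p : hom Y (sval E)) phi :
  pullback f (cl p phi) = cl (p \oc f) phi.
Proof.
rewrite /pullback; set rho := repr_of _.
have : pi Y (rho - act G (lift p) phi) = 0 by rewrite raddfB repr_ofK subrr.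
case/pi_ker=> [E' [k [psi [k0 /eqP]]]]; rewrite subr_eq => /eqP ->.
rewrite clD -!cl_comp !(@comp_assoc C) liftP k0.
by rewrite comp0l cl0p add0r.
Qed.

Lemma cl_surj X (z : Q X) : exists (phi : G (B X)), z = cl (eta X) phi.
Proof. by exists (repr_of z); rewrite cl_eta repr_ofK. Qed.

Lemma pullback_nmod X Y (f : hom X Y) : nmod_morphism (pullback f).
Proof.
split=> [|x y].
  by rewrite -(cl0p Y (0 : G (B X))) pullback_cl comp0l cl0p.
have [phi ->] := cl_surj x; have [psi ->] := cl_surj y.
by rewrite -clD !pullback_cl clD.
Qed.

HB.instance Definition _ X Y (f : hom X Y) :=
  GRing.isNmodMorphism.Build (Q Y) (Q X) (pullback f) (pullback_nmod f).

Definition extension : functor (opcat C) Ab.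
Proof.
apply: (@Functor (opcat C) Ab (fun X : C => Q X)
  (fun X Y (f : @hom C Y X) => (pullback f : {additive Q X -> Q Y}))).
- move=> X; apply: additiveP => z /=; have [phi ->] := cl_surj z.
  by rewrite pullback_cl comp_idr.
- move=> X Y Z g f; apply: additiveP => z /=; have [phi ->] := cl_surj z.
  by rewrite !pullback_cl comp_assoc.
Defined.

Lemma act_extension X Y (f : hom X Y) (E : wge_cat w) (p : hom Y (sval E)) phi :
  act extension f (cl p phi) = cl (p \oc f) phi.
Proof. exact: pullback_cl. Qed.

Lemma extension_additive : additive_presheaf extension.
Proof.
move=> X Y f g z; have [phi ->] := cl_surj z.
have := act_extension; rewrite /act => h.
by rewrite !h compDr clDp.
Qed.

Hypothesis Gexact : forall (X Y Z : wge_cat w) (f : @hom (wge_cat w) X Y)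
    (g : @hom (wge_cat w) Y Z) (h : hom (sval Z) (shift (sval X))),
  @distinguished C _ _ _ f g h ->
  forall y : G Y, act G f y = 0 -> exists z, act G g z = y.

Lemma cl_eq0 X (E : wge_cat w) (p : hom X (sval E)) (phi : G E) :
  cl p phi = 0 ->
  exists (E' : wge_cat w) (k : @hom (wge_cat w) E E') (psi : G E'),
    @comp C _ _ _ k p = 0 /\ phi = act G k psi.
Proof.
case/pi_ker=> E1 [k [psi [k0 phiE]]].
have [S bS] := (tr_additive C).2 (sval E1) (sval E).
have wS := w_ge_biproduct bS (svalP E1) (svalP E).
have [i [j [r [q [ri qj rj qi _]]]]] := bS.
(* [E'] is the weak pushout of [k] and [lift p]. *)
have [W [m [d dist]]] := dist_cone
  ((i \oc (k : hom (sval (B X)) (sval E1)))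
   - (j \oc (lift p : hom (sval (B X)) (sval E)))).
have wW := w_ge_cone dist (svalP (B X)) wS.
pose S1 : wge_cat w := exist _ S wS; pose W1 : wge_cat w := exist _ W wW.
pose r1 : @hom (wge_cat w) S1 E1 := r; pose q1 : @hom (wge_cat w) S1 E := q.
pose m1 : @hom (wge_cat w) S1 W1 := m; pose j1 : @hom (wge_cat w) E S1 := j.
pose n : @hom (wge_cat w) (B X) S1 :=
  @comp C _ _ _ i k - @comp C _ _ _ j (lift p).
have rn : r1 \oc n = k.
  have := compBr r (i \oc (k : hom (sval (B X)) (sval E1)))
            (j \oc (lift p : hom (sval (B X)) (sval E))).
  by rewrite !comp_assoc ri rj comp0l subr0 comp_idl.
have qn : q1 \oc n = - lift p.
  have := compBr q (i \oc (k : hom (sval (B X)) (sval E1)))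
            (j \oc (lift p : hom (sval (B X)) (sval E))).
  by rewrite !comp_assoc qj qi comp0l sub0r comp_idl.
have [|z zE] := @Gexact (B X) S1 W1 n m1 d dist (act G r1 psi + act G q1 phi).
  by rewrite raddfD /= -!act_comp rn qn actN // phiE subrr.
exists W1, (m1 \oc j1), z; split.
  have := dist_comp0 dist; rewrite compBr => /eqP; rewrite subr_eq0 => /eqP mE.
  rewrite -(liftP p) [LHS](@comp_assoc C).
  have -> : @comp C _ _ _ (m1 \oc j1) (lift p) =
      m \oc (i \oc (k : hom (sval (B X)) (sval E1))).
    by rewrite mE [RHS]comp_assoc.
  by rewrite -!comp_assoc k0 !comp0r.
have rj1 : r1 \oc j1 = 0 by exact: rj.
have qj1 : q1 \oc j1 = idm E by exact: qj.
by rewrite act_comp zE raddfD /= -!act_comp rj1 qj1 act_id act0 // add0r.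
Qed.

Lemma extension_cohomological : cohomological extension.
Proof.
split; first exact: extension_additive.
move=> X Y Z f g h fgh y; have [phi ->] := cl_surj y.
split=> [|[z <-]]; last first.
  have [psi ->] := cl_surj z.
  have := act_extension; rewrite /act => a.
  by rewrite !a -comp_assoc (dist_comp0 fgh) comp0r cl0p.
have := act_extension; rewrite /act => a; rewrite a.
case/cl_eq0=> [E [k [psi [k0 ->]]]].
rewrite comp_assoc in k0.
have [v vE] := dist_weak_cokernel fgh k0.
by exists (cl v psi); rewrite a -vE cl_comp.
Qed.

Hypothesis Gprod : respects_products G.
Hypothesis hcoprod : has_coproducts C.
Hypothesis wsm : coproduct_closed (w_ge w).

Section OneCoproduct.
Variables (I : smallType) (E : I -> wge_cat w) (S : C).
Variable inj : forall i, hom (sval (E i)) S.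
Hypothesis cS : is_coproduct inj.

Definition coproduct_ob : wge_cat w :=
  exist _ S (wsm cS (fun i => svalP (E i))).

Lemma presheaf_coproduct : @is_product Ab I (fun i => G (E i)) (G coproduct_ob)
  (fun i => act G (inj i : @hom (wge_cat w) (E i) coproduct_ob)).
Proof.
exact: (Gprod (coproduct_to_subcat (S := coproduct_ob) (inj := inj) cS)).
Qed.

End OneCoproduct.

Lemma extension_products : respects_products extension.
Proof.
move=> I X S inj cS.
have [F [inF cF]] := hcoprod (fun i => sval (B (X i))).
have [s sE] := coproduct_desc (fun i => inF i \oc eta (X i)) cS.
pose F1 := coproduct_ob cF.
pose inF1 i : @hom (wge_cat w) (B (X i)) F1 := inF i.
apply: ab_product => [z z0|a]; last first.
  have /dependent_choice[phi phiE] :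
      forall i, exists phi, a i = cl (eta (X i)) phi.
    by move=> i; apply: cl_surj.
  have [Phi PhiE] := ab_product_surj (presheaf_coproduct cF) phi.
  exists (cl (E := F1) s Phi) => i.
  by rewrite [LHS]act_extension sE phiE (cl_comp (inF1 i)) PhiE.
have [theta zE] := cl_surj z.
have /dependent_choice[E hE] : forall i, exists E : wge_cat w,
    exists (k : @hom (wge_cat w) (B (X i)) E) (psi : G E),
    @comp C _ _ _ k (eta (X i)) = 0 /\
    act G (lift (eta S \oc inj i)) theta = act G k psi.
  move=> i; apply/pi_ker.
  by rewrite -[LHS](act_extension (inj i)) -zE; apply: z0.
have /dependent_choice[k /dependent_choice[psi kpsi]] := hE.
have [T [inT cT]] := hcoprod (fun i => sval (E i)).
pose T1 := coproduct_ob cT.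
pose inT1 i : @hom (wge_cat w) (E i) T1 := inT i.
have [Psi PsiE] := ab_product_surj (presheaf_coproduct cT) psi.
have [K KE] := coproduct_desc
  (fun i => inT i \oc (k i : hom (sval (B (X i))) (sval (E i)))) cF.
have [u uE] := coproduct_desc
  (fun i => lift (eta S \oc inj i) : hom _ (sval (B S))) cF.
pose K1 : @hom (wge_cat w) F1 T1 := K.
pose u1 : @hom (wge_cat w) F1 (B S) := u.
have us : u \oc s = eta S.
  apply: (coproduct_ext cS) => i.
  by rewrite -comp_assoc sE comp_assoc uE liftP.
have Ks : K \oc s = 0.
  apply: (coproduct_ext cS) => i.
  rewrite -comp_assoc sE comp_assoc KE -comp_assoc (kpsi i).1.
  by rewrite comp0r comp0l.
have uK : act G u1 theta = act G K1 Psi.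
  apply: (ab_product_inj (presheaf_coproduct cF)) => i.
  rewrite -!(act_comp (F := G)).
  have -> : u1 \oc inF1 i = lift (eta S \oc inj i) by exact: uE.
  have -> : K1 \oc inF1 i = inT1 i \oc k i by exact: KE.
  by rewrite act_comp PsiE (kpsi i).2.
rewrite zE -us (cl_comp u1) uK -(cl_comp K1) -(cl0p S Psi).
by congr (cl _ _); apply: Ks.
Qed.

Lemma extension_universal :
  representable extension ->
  exists (L : wge_cat w) (x : G L), universal_element x.
Proof.
move=> /representable_universal[L0 [xi xiU]].
have [phi xiE] := cl_surj xi.
have wL : w_ge w L0.
  apply: w_ge_orthogonal => A f wA.
  have [g [_ gU]] := xiU A 0.
  rewrite -(gU f) ?(gU 0) ?act0 //; first exact: extension_additive.
  rewrite xiE act_extension.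
  rewrite (shift_w_le_ge_eq0 (eta L0 \oc f) wA (svalP (B L0))).
  exact: cl0p.
pose L : wge_cat w := exist _ L0 wL.
pose etaL : @hom (wge_cat w) L (B L0) := eta L0.
pose x : G L := act G etaL phi.
have xi1 : xi = cl (E := L) (idm L0) x.
  by rewrite -cl_comp comp_idr.
have cl1_inj (E : wge_cat w) (y z : G E) :
    cl (idm (sval E)) y = cl (idm (sval E)) z -> y = z.
  move=> /eqP; rewrite -subr_eq0 -clB => /eqP/cl_eq0[E' [k [psi [k0 yz]]]].
  apply/eqP; rewrite -subr_eq0 yz; apply/eqP.
  by rewrite comp_idr in k0; rewrite [k]k0 act0.
have act_xi (E : wge_cat w) (f : @hom (wge_cat w) E L) :
    act extension (f : hom (sval E) L0) xi = cl (idm (sval E)) (act G f x).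
  by rewrite xi1 act_extension comp_idl -cl_comp comp_idr.
exists L, x => E y.
have [f [fE fU]] := xiU (sval E) (cl (idm (sval E)) y).
exists f; split=> [|g gE]; first by apply: cl1_inj; rewrite -act_xi.
by apply: fU; rewrite (act_xi E g) gE.
Qed.

End KanExtension.

Lemma relative_brown_representability (C : triangulated)
    (w : weight_structure C) (G : functor (opcat (wge_cat w)) Ab) :
  has_coproducts C -> brown_representability C -> coproduct_closed (w_ge w) ->
  additive_presheaf G -> respects_products G ->
  (forall (X Y Z : wge_cat w) (f : @hom (wge_cat w) X Y)
      (g : @hom (wge_cat w) Y Z) (h : hom (sval Z) (shift (sval X))),
    @distinguished C _ _ _ f g h ->
    forall y : G Y, act G f y = 0 -> exists z, act G g z = y) ->
  exists (L : wge_cat w) (x : G L), universal_element x.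
Proof.
move=> hcoprod hbrown wsm Gadd Gprod Gexact.
have /dependent_choice[B /dependent_choice[eta refl]] : forall X : C,
    exists B : wge_cat w, exists eta : hom X (sval B),
    forall (E : wge_cat w) (p : hom X (sval E)),
      exists q : hom (sval B) (sval E), q \oc eta = p.
  move=> X; have [B [eta [wB h]]] := weak_reflection w X.
  exists (exist _ B wB), eta => E p.
  by have [q ->] := h _ p (svalP E); exists q.
have /dependent_choice[lift0 liftP] :
    forall (a : {X : C & {E : wge_cat w & hom X (sval E)}}),
    exists q : hom (sval (B (projT1 a))) (sval (projT1 (projT2 a))),
      q \oc eta _ = projT2 (projT2 a) by case=> X [E p]; apply: refl.
pose lift X E (p : hom X (sval E)) : @hom (wge_cat w) (B X) E :=
  lift0 (existT _ X (existT _ E p)).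
have {}liftP X E (p : hom X (sval E)) : @comp C _ _ _ (@lift X E p) (eta X) = p.
  exact: (liftP (existT _ X (existT _ E p))).
have /dependent_choice[Q /dependent_choice[pi piE]] : forall X : C,
    exists (Q : zmodType), exists pi : {additive G (B X) -> Q},
    (forall z, exists x, pi x = z) /\ forall x, pi x = 0 <-> negligible eta x.
  move=> X; apply: quotient_exists; first exact: negligible0.
  exact: negligibleB.
have pi_surj X := (piE X).1; have pi_ker X := (piE X).2.
apply: (@extension_universal _ _ _ Gadd _ _ _ liftP _ pi pi_surj pi_ker) => //.
by apply: hbrown; [apply: extension_cohomological|apply: extension_products].
Qed.

(** * The adjacent t-structure *)

Section RestrictedPresheaves.
Variables (C : preadditive) (P : C -> Prop).

Definition restriction (F : functor (opcat C) Ab) :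
  functor (opcat (full_presubcat P)) Ab.
Proof.
apply: (@Functor (opcat (full_presubcat P)) Ab (fun X => F (sval X))
  (fun X Y (f : @hom C (sval Y) (sval X)) => fmap F f)).
- by move=> X; apply: (fmap_id F).
- by move=> X Y Z g f; apply: (fmap_comp F).
Defined.

Lemma restriction_additive (F : functor (opcat C) Ab) :
  additive_presheaf F -> additive_presheaf (restriction F).
Proof. by move=> Fadd X Y f g; apply: Fadd. Qed.

Lemma representable_additive (M : C) :
  additive_presheaf (representable_presheaf M).
Proof. by move=> X Y f g y; apply: compDr. Qed.

Lemma representable_products (M : C) :
  respects_products (representable_presheaf M).
Proof.
move=> I X S inj cS; apply: ab_product => [x x0|a].
  by apply: (coproduct_ext cS) => i; rewrite comp0l; apply: x0.
by have [g gE] := coproduct_desc (a : forall i, hom (X i) M) cS; exists g.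
Qed.

End RestrictedPresheaves.

Lemma restriction_products (C : triangulated) (P : C -> Prop)
  (F : functor (opcat C) Ab) :
  has_coproducts C -> coproduct_closed P -> respects_products F ->
  respects_products (restriction P F).
Proof.
move=> hC cP Fprod I X S inj cS.
have [S' [inj' cS']] := hC I (fun i => sval (X i)).
have PS' : P S' by apply: cP cS' _ => i; apply: svalP.
exact: Fprod (coproduct_of_subcat cS' PS' cS).
Qed.

Lemma dist_fiber (C : triangulated) (L E : C) (u : hom E (shift L)) :
  exists (Q : C) (l : hom L Q) (q : hom Q E), distinguished l q u.
Proof.
have [W [a [b uab]]] := dist_cone u.
have [Q [c' [c [cc' c'c]]]] := shift_ess_surj W.
have [l lE] := shift_full (- (c \oc a)).
have [q qE] := shift_full (- (b \oc c')).
exists Q, l, q; apply/dist_rotate; apply/dist_rotate.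
apply: (dist_iso (a := idm E) (b := idm (shift L)) (c := c) (a' := idm E)
  (b' := idm _) (c' := c') _ _ _ _ c'c cc' _ _ _ uab); rewrite ?comp_idl //.
- by rewrite comp_idr.
- by rewrite comp_idr lE opprK.
- by rewrite fmap_id comp_idl qE opprK -comp_assoc c'c comp_idr.
Qed.

Section AdjacentTStructure.
Variables (C : triangulated) (w : weight_structure C).

Lemma coreflection (M : C) : has_coproducts C -> brown_representability C ->
  coproduct_closed (w_ge w) ->
  exists (L : C) (x : hom L M), w_ge w L /\
    forall (E : C) (y : hom E M), w_ge w E -> exists! f : hom E L, x \oc f = y.
Proof.
move=> hC hB wsm.
have [|||L [x xU]] := @relative_brown_representability C w
    (restriction (w_ge w) (representable_presheaf M)) hC hB wsm.
- exact/restriction_additive/representable_additive.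
- exact/restriction_products/representable_products.
- move=> X Y Z f g h fgh y yf.
  by have [v ->] := dist_weak_cokernel fgh yf; exists v.
exists (sval L), x; split=> [|E y wE]; first exact: svalP.
exact: (xU (exist _ E wE) y).
Qed.

Definition right_orthogonal (X : C) : Prop :=
  forall (E : C) (f : hom (shift E) X), w_ge w E -> f = 0.

Section Truncation.
Variables (L M R : C) (x : hom L M) (g : hom M R) (h : hom R (shift L)).
Hypothesis xgh : distinguished x g h.
Hypothesis wL : w_ge w L.
Hypothesis xU : forall (E : C) (y : hom E M), w_ge w E ->
  exists! f : hom E L, x \oc f = y.

(* As in Wakamatsu's lemma: the extension of [E] by [L] pulled back along [f]
   maps to [M], hence to [L], which splits it. *)
Lemma coreflection_cone (E : C) (f : hom E R) : w_ge w E -> f = 0.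
Proof.
move=> wE; have [Q [l [q lqu]]] := dist_fiber (h \oc f).
have wQ := w_ge_extension lqu wL wE.
have d1 := dist_rot (dist_rot lqu).
have d2 := dist_rot (dist_rot xgh).
have [|c [cl _]] := dist_morphism d1 d2 (a := f) (b := idm (shift L)).
  by rewrite comp_idl.
have [m mE] := shift_full c.
have ml : m \oc l = x.
  apply: shift_faithful; rewrite fmap_comp mE; apply: oppr_inj.
  by rewrite -compNr cl comp_idr.
have [m' [xm' _]] := xU m wQ.
have m'l : m' \oc l = idm L.
  have [k [_ kU]] := xU x wL.
  by rewrite -(kU (m' \oc l)) ?(kU (idm L)) ?comp_idr // comp_assoc xm'.
have hf0 : h \oc f = 0.
  have := dist_comp0 d1; rewrite compNl => /eqP; rewrite oppr_eq0 => /eqP l0.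
  by rewrite -[LHS]comp_idl -fmap_id -m'l fmap_comp -comp_assoc l0 comp0r.
have [v ->] := dist_weak_kernel (dist_rot xgh) hf0.
have [v' [<- _]] := xU v wE.
by rewrite comp_assoc (dist_comp0 xgh) comp0l.
Qed.

End Truncation.

Lemma adjacent_t_structure_exists : has_coproducts C ->
  brown_representability C -> coproduct_closed (w_ge w) ->
  exists t : t_structure C, right_adjacent t w.
Proof.
move=> hC hB wsm.
have le_iso : iso_closed (w_ge w).
  by move=> X Y XY; apply/w_ge_retract/iso_retract.
have ge_iso : iso_closed right_orthogonal.
  move=> X Y [u [v [vu uv]]] oX E f wE.
  by rewrite -[f]comp_idl -uv -comp_assoc (oX E (v \oc f) wE) comp0r.
have ge_shift : subclass right_orthogonal (shifted right_orthogonal).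
  move=> X oX; have [Y [u [v [vu uv]]]] := shift_ess_surj X.
  exists Y; last by exists v, u.
  move=> E f wE; apply: shift_eq0.
  rewrite -[LHS]comp_idl -vu -comp_assoc (oX _ (u \oc fmap shift f)) ?comp0r //.
  exact: w_ge_shift1.
have orth : orthogonal (w_ge w) (unshifted right_orthogonal).
  move=> X Y wX [Z oZ [u [v [vu uv]]]] f; apply: shift_eq0.
  by rewrite -[LHS]comp_idl -vu -comp_assoc (oZ X (u \oc fmap shift f)) ?comp0r.
have dec : has_decompositions (w_ge w) (unshifted right_orthogonal).
  move=> M; have [L [x [wL xU]]] := coreflection M hC hB wsm.
  have [R [g [h xgh]]] := dist_cone x.
  exists L, R, x, g, h; split=> //.
  exists (shift R); last by exists (idm _), (idm _); rewrite comp_idl.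
  move=> E f wE; have [f' <-] := shift_full f.
  by rewrite (coreflection_cone xgh wL xU f' wE) shift0.
by exists (TStructure le_iso ge_iso (@w_ge_shift C w) ge_shift orth dec).
Qed.

Variable t : t_structure C.
Hypothesis tw : right_adjacent t w.

Lemma right_adjacent_coproduct_closed : coproduct_closed (w_ge w).
Proof.
move=> I X S inj cS wX.
have [L [R [f [g [h [fgh tL tR]]]]]] := t_decomposition t S.
have g0 : g = 0.
  apply: (coproduct_ext cS) => i; rewrite comp0l.
  by apply: (t_orthogonal (t := t)) tR _; apply/tw.
have [|v fv] := dist_weak_kernel fgh (u := idm S); first by rewrite g0 comp0l.
by apply: (w_ge_retract (X := L)); [exists v, f | apply/tw].
Qed.

Lemma t_geE (X : C) : t_ge t X <-> right_orthogonal X.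
Proof.
split=> [tX E f wE|oX].
  have [Y tY [u [v [vu uv]]]] := t_ge_shift tX.
  have [f' f'E] := shift_full (u \oc f).
  rewrite -[f]comp_idl -vu -comp_assoc -f'E.
  have tE : t_le t E by apply/tw.
  rewrite (t_orthogonal tE _ f') ?shift0 ?comp0r //.
  by exists X => //; exists v, u.
have [Y [u [v [vu uv]]]] := shift_ess_surj X.
have [L [R [f [g [h [fgh tL [Z tZ RZ]]]]]]] := t_decomposition t Y.
have wL : w_ge w L by apply/tw.
have f0 : f = 0.
  apply: shift_eq0.
  by rewrite -[LHS]comp_idl -vu -comp_assoc (oX L (u \oc fmap shift f)) ?comp0r.
have [|r rg] := dist_weak_cokernel fgh (u := idm Y).
  by rewrite comp_idl.
have [|s hs] := dist_weak_kernel (dist_rot (dist_rot fgh)) (u := idm (shift L)).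
  by rewrite f0 shift0 oppr0 comp0l.
have s0 : s = 0.
  apply: (t_orthogonal (t := t)); last by exists Z.
  by apply/tw; apply: w_ge_shift1.
have h0 : h = 0 by rewrite -[h]comp_idl hs s0 comp0r comp0l.
have [|q gq] := dist_weak_kernel (dist_rot fgh) (u := idm R).
  by rewrite h0 comp0l.
have rgq : r = q by rewrite -[r]comp_idr gq comp_assoc -rg comp_idl.
have qg : q \oc g = idm Y by rewrite -rgq -rg.
apply: (t_ge_iso _ (t_ge_iso (iso_sym RZ) tZ)).
exists (u \oc fmap shift q), (fmap shift g \oc v); split.
  by rewrite -comp_assoc (comp_assoc v) vu comp_idl -fmap_comp -gq fmap_id.
by rewrite -comp_assoc (comp_assoc _ _ v) -fmap_comp qg fmap_id comp_idl.
Qed.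

End AdjacentTStructure.

(** * The heart of the adjacent t-structure *)

Lemma heart_presentation (C : triangulated) (w : weight_structure C)
    (B : wge_cat w) :
  exists (A : w_heart w) (K : wge_cat w) (k : hom (sval K) (sval A))
    (a : hom (sval A) (sval B)) (d : hom (sval B) (shift (sval K))),
    distinguished k a d.
Proof.
have [A [K [k [a [d [kad wA wK]]]]]] := weight_triangle w (sval B).
have wA' : w_ge w A := w_ge_extension kad wK (svalP B).
by exists (exist _ A (conj wA wA')), (exist _ K wK), k, a, d.
Qed.

Section PurePresheaf.
Variables (C : triangulated) (w : weight_structure C).
Variable F : functor (opcat (w_heart w)) Ab.
Hypothesis Fadd : additive_presheaf F.

Variables (A : wge_cat w -> w_heart w) (K : wge_cat w -> wge_cat w).
Variables (k : forall B, hom (sval (K B)) (sval (A B)))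
  (a : forall B, hom (sval (A B)) (sval B))
  (d : forall B, hom (sval B) (shift (sval (K B)))).
Hypothesis kad : forall B, distinguished (k B) (a B) (d B).

Lemma heart_lift (B : wge_cat w) (Q : w_heart w) (b : hom (sval Q) (sval B)) :
  exists l : @hom (w_heart w) Q (A B), @comp C _ _ _ (a B) l = b.
Proof.
have [|l ->] := dist_weak_kernel (dist_rot (kad B)) (u := b).
  exact: (w_le_ge_eq0 _ (svalP Q).1 (svalP (K B))).
by exists l.
Qed.

Definition relation_free (B : wge_cat w) (x : F (A B)) : Prop :=
  forall (Q : w_heart w) (r : @hom (w_heart w) Q (A B)),
    @comp C _ _ _ (a B) r = 0 -> act F r x = 0.

Lemma relation_free0 B : relation_free (0 : F (A B)).
Proof. by move=> Q r _; rewrite raddf0. Qed.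

Lemma relation_freeB B (x y : F (A B)) :
  relation_free x -> relation_free y -> relation_free (x - y).
Proof. by move=> Rx Ry Q r r0; rewrite raddfB Rx // Ry // subrr. Qed.

Variables (G0 : wge_cat w -> zmodType).
Variable iota : forall B, {additive G0 B -> F (A B)}.
Hypothesis iota_inj : forall B, injective (iota B).
Hypothesis iota_im : forall B x, relation_free x <-> exists y, iota B y = x.

(* [G0 B] is the group of natural transformations from [hom _ B], restricted
   to the heart, to [F]; [ev] is their evaluation. *)
Definition ev (B : wge_cat w) (x : G0 B) (Q : w_heart w)
  (b : hom (sval Q) (sval B)) : F Q :=
  act F (projT1 (cid (heart_lift b))) (iota B x).

Lemma evE B (x : G0 B) (Q : w_heart w) (l : @hom (w_heart w) Q (A B)) b :
  @comp C _ _ _ (a B) l = b -> ev x b = act F l (iota B x).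
Proof.
move=> lb; rewrite /ev; have := projT2 (cid (heart_lift b)).
set l' := projT1 _ => l'b.
apply/eqP; rewrite -subr_eq0 -(actB (F := F)) //; apply/eqP.
have [_] := iota_im (iota B x); apply; first by exists x.
by rewrite compBr l'b lb subrr.
Qed.

Lemma ev_a B (x : G0 B) : ev x (a B) = iota B x.
Proof. by rewrite (@evE _ _ _ (idm (A B))) ?act_id // comp_idr. Qed.

Lemma ev_comp B (x : G0 B) (Q Q' : w_heart w) (b : hom (sval Q) (sval B))
  (c : @hom (w_heart w) Q' Q) : ev x (@comp C _ _ _ b c) = act F c (ev x b).
Proof.
have [l lb] := heart_lift b.
rewrite (evE x lb) (@evE _ _ _ (l \oc c)) ?act_comp //.
by rewrite -lb; apply: comp_assoc.
Qed.

Lemma evDb B (x : G0 B) (Q : w_heart w) (b c : hom (sval Q) (sval B)) :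
  ev x (b + c : hom (sval Q) (sval B)) = ev x b + ev x c.
Proof.
have [l lb] := heart_lift b; have [m mc] := heart_lift c.
rewrite (evE x lb) (evE x mc) (@evE _ _ _ (l + m)) ?actD //.
by rewrite compDr lb mc.
Qed.

Lemma ev0b B (x : G0 B) (Q : w_heart w) :
  ev x (0 : hom (sval Q) (sval B)) = 0.
Proof. by rewrite (@evE _ _ _ 0) ?act0 // comp0r. Qed.

Lemma evD B (x y : G0 B) (Q : w_heart w) (b : hom (sval Q) (sval B)) :
  ev (x + y) b = ev x b + ev y b.
Proof. by rewrite /ev !raddfD. Qed.

Lemma ev0 B (Q : w_heart w) (b : hom (sval Q) (sval B)) : ev 0 b = 0.
Proof. by rewrite /ev !raddf0. Qed.

Lemma ev_inj B (x y : G0 B) :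
  (forall (Q : w_heart w) (b : hom (sval Q) (sval B)), ev x b = ev y b) ->
  x = y.
Proof. by move=> xy; apply: iota_inj; rewrite -(ev_a x) -(ev_a y) xy. Qed.

Lemma ev_exists B (x0 : F (A B)) : relation_free x0 ->
  exists x : G0 B, forall (Q : w_heart w) (l : @hom (w_heart w) Q (A B)),
    ev x (@comp C _ _ _ (a B) l) = act F l x0.
Proof.
move=> /iota_im[x <-]; exists x => Q l; exact: evE.
Qed.

Lemma pure_map_exists (B B' : wge_cat w) (f : @hom (wge_cat w) B B') :
  exists g : {additive G0 B' -> G0 B},
    forall (y : G0 B') (Q : w_heart w) (b : hom (sval Q) (sval B)),
      ev (g y) b = ev y (@comp C _ _ _ f b).
Proof.
have /dependent_choice[g gE] : forall y : G0 B', exists x : G0 B,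
    forall (Q : w_heart w) (b : hom (sval Q) (sval B)),
      ev x b = ev y (@comp C _ _ _ f b).
  move=> y; have [|x xE] := @ev_exists B (ev y (@comp C _ _ _ f (a B))).
    move=> Q r r0; rewrite -ev_comp -[X in ev y X](@comp_assoc C) r0.
    by rewrite comp0r ev0b.
  exists x => Q b; have [l <-] := heart_lift b.
  by rewrite xE (@comp_assoc C) ev_comp.
have g_nmod : nmod_morphism g.
  split=> [|x y]; apply: ev_inj => Q b; rewrite ?evD !gE ?ev0 //.
  exact: evD.
pose gA : {additive G0 B' -> G0 B} :=
  HB.pack (g : G0 B' -> G0 B) (GRing.isNmodMorphism.Build _ _ g g_nmod).
by exists gA.
Qed.

Definition pure_map (B B' : wge_cat w) (f : @hom (wge_cat w) B B') :
  {additive G0 B' -> G0 B} := projT1 (cid (pure_map_exists f)).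

Lemma ev_pure_map (B B' : wge_cat w) (f : @hom (wge_cat w) B B') (y : G0 B')
    (Q : w_heart w) (b : hom (sval Q) (sval B)) :
  ev (pure_map f y) b = ev y (@comp C _ _ _ f b).
Proof. by rewrite /pure_map; case: cid. Qed.

Definition pure_presheaf : functor (opcat (wge_cat w)) Ab.
Proof.
apply: (@Functor (opcat (wge_cat w)) Ab (fun B => G0 B)
  (fun B B' (f : @hom (wge_cat w) B' B) => pure_map f)).
- move=> B; apply: additiveP => x; apply: ev_inj => Q b.
  by rewrite ev_pure_map comp_idl.
- move=> X Y Z g f; apply: additiveP => x; apply: ev_inj => Q b.
  by rewrite /= !ev_pure_map; congr ev; rewrite [RHS]comp_assoc.
Defined.

Lemma ev_act (B B' : wge_cat w) (f : @hom (wge_cat w) B B') (y : G0 B')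
    (Q : w_heart w) (b : hom (sval Q) (sval B)) :
  ev (act pure_presheaf f y) b = ev y (@comp C _ _ _ f b).
Proof. exact: ev_pure_map. Qed.

Lemma pure_presheaf_additive : additive_presheaf pure_presheaf.
Proof.
move=> X Y f g y; apply: ev_inj => Q b.
rewrite evD; have := ev_act; rewrite /act => h.
by rewrite !h compDl evDb.
Qed.

Lemma pure_presheaf_exact (X Y Z : wge_cat w) (f : @hom (wge_cat w) X Y)
    (g : @hom (wge_cat w) Y Z) (h : hom (sval Z) (shift (sval X))) :
  @distinguished C _ _ _ f g h ->
  forall y : pure_presheaf Y, act pure_presheaf f y = 0 ->
    exists z, act pure_presheaf g z = y.
Proof.
move=> fgh y yf.
have y0 (Q : w_heart w) (b : hom (sval Q) (sval Y)) :
    @comp C _ _ _ g b = 0 -> ev y b = 0.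
  move=> /(dist_weak_kernel fgh)[c ->].
  by rewrite -(ev_act f) yf ev0.
have [|s sE] := dist_weak_kernel (dist_rot fgh) (u := a Z).
  exact: (w_le_ge_eq0 _ (svalP (A Z)).1 (svalP X)).
have [|z zE] := @ev_exists Z (ev y s).
  move=> Q r r0; rewrite -ev_comp; apply: y0.
  by rewrite comp_assoc -sE r0.
exists z; apply: ev_inj => Q b; rewrite ev_act.
have [l lE] := heart_lift (@comp C _ _ _ g b).
rewrite -lE zE -ev_comp; apply/eqP; rewrite -subr_eq0; apply/eqP.
set sl := (X in ev y X).
have -> : sl = (sl - b) + b by rewrite subrK.
rewrite evDb addrK; apply: y0.
by rewrite compBr /sl comp_assoc -sE lE subrr.
Qed.

Hypothesis Fprod : respects_products F.
Hypothesis hcoprod : has_coproducts C.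
Hypothesis wsm : coproduct_closed (w_ge w).

Lemma shift_coproduct (I : smallType) (X : I -> C) (S : C)
    (inj : forall i, hom (X i) S) :
  is_coproduct inj -> is_coproduct (fun i => fmap shift (inj i)).
Proof. exact: equivalence_coproduct (shift_equivalence C). Qed.

Lemma heart_cover_coproduct (I : smallType) (E : I -> wge_cat w) (S : C)
    (inj : forall i, hom (sval (E i)) S) :
  is_coproduct inj -> exists (AS : w_heart w)
    (inA : forall i, @hom (w_heart w) (A (E i)) AS) (aS : hom (sval AS) S),
  [/\ @is_coproduct C I (fun i => sval (A (E i))) (sval AS) inA,
      (forall i, aS \oc inA i = inj i \oc a (E i)) &
      forall (Q : w_heart w) (b : hom (sval Q) S),
        exists l : @hom (w_heart w) Q AS, b = aS \oc l].
Proof.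
move=> cS.
have [AS0 [inA cA]] := hcoprod (fun i => sval (A (E i))).
have wAS : w_le w AS0 /\ w_ge w AS0.
  split; first by apply: w_le_coproduct cA _ => i; case: (svalP (A (E i))).
  by apply: wsm cA _ => i; case: (svalP (A (E i))).
have [KS [inK cK]] := hcoprod (fun i => sval (K (E i))).
have wKS : w_ge w KS by apply: wsm cK _ => i; apply: svalP.
have [aS aSE] := coproduct_desc (fun i => inj i \oc a (E i)) cA.
have [dS dSE] := coproduct_desc (fun i => fmap shift (inK i) \oc d (E i)) cS.
exists (exist _ AS0 wAS), inA, aS; split=> // Q b.
apply: (coproduct_weak_kernel cA cS (shift_coproduct cK) _ aSE dSE).
  by move=> i T u; apply: (dist_weak_cokernel (dist_rot (kad (E i)))).
exact: (w_le_ge_eq0 _ (svalP Q).1 wKS).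
Qed.

Lemma pure_presheaf_products : respects_products pure_presheaf.
Proof.
move=> I E S inj cS.
have [S' [inj' cS']] := hcoprod (fun i => sval (E i)).
have wS' : w_ge w S' by apply: wsm cS' _ => i; apply: svalP.
have {S' inj' cS' wS'} cS := coproduct_of_subcat cS' wS' cS.
have [AS [inA [aS [cA aSE AS_lift]]]] := heart_cover_coproduct cS.
have prodA := Fprod (coproduct_to_subcat cA).
apply: ab_product => [x x0|x].
  have [l aE] := AS_lift _ (a S).
  have evx0 : ev x aS = 0.
    apply: (ab_product_inj prodA) => i.
    rewrite raddf0 -[LHS]ev_comp [X in ev x X]aSE -(ev_act (inj i)).
    by rewrite [X in ev X]x0 ev0.
  by apply: iota_inj; rewrite raddf0 -ev_a aE ev_comp evx0 raddf0.
have [xA xAE] := ab_product_surj prodA (fun i => iota (E i) (x i)).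
have xA_free (Q : w_heart w) (r : @hom (w_heart w) Q AS) :
    @comp C _ _ _ aS r = 0 -> act F r xA = 0.
  move=> r0.
  have [KS [inK cK]] := hcoprod (fun i => sval (K (E i))).
  have [kS kSE] := coproduct_desc
    (fun i => (inA i : hom (sval (A (E i))) (sval AS)) \oc k (E i)) cK.
  have [r' r'E] : exists r', (r : hom (sval Q) (sval AS)) = kS \oc r'.
    apply: (coproduct_weak_kernel cK cA cS _ kSE aSE) => // i T u.
    exact: (dist_weak_cokernel (kad (E i))).
  have [AK [inAK [aK [cAK aKE AK_lift]]]] := heart_cover_coproduct cK.
  have [m r'm] := AK_lift _ r'.
  pose n : @hom (w_heart w) AK AS := kS \oc aK.
  have -> : r = n \oc m by rewrite [LHS]r'E r'm [LHS]comp_assoc.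
  rewrite act_comp; suff -> : act F n xA = 0 by rewrite raddf0.
  apply: (ab_product_inj (Fprod (coproduct_to_subcat cAK))) => i.
  rewrite raddf0 -[LHS](act_comp (F := F)).
  pose ki : @hom (w_heart w) (A (K (E i))) (A (E i)) := k (E i) \oc a (K (E i)).
  have -> : n \oc inAK i = inA i \oc ki.
    rewrite -[LHS](@comp_assoc C) [X in kS \oc X](aKE i).
    by rewrite [LHS](@comp_assoc C) [RHS](@comp_assoc C) kSE.
  rewrite act_comp [act F (inA i) xA]xAE.
  have [_] := iota_im (iota (E i) (x i)); apply; first by exists (x i).
  by rewrite comp_assoc (dist_comp0 (kad (E i))) comp0l.
have [l lE] := AS_lift _ (a S).
have [|y yE] := @ev_exists S (act F l xA).
  move=> Q r r0; rewrite -act_comp; apply: xA_free.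
  by rewrite [LHS](@comp_assoc C) -lE r0.
exists y => i; apply: iota_inj; rewrite -!ev_a [LHS](ev_act (inj i)).
have [m mE] := heart_lift (@comp C _ _ _ (inj i) (a (E i))).
rewrite -mE yE -act_comp ev_a -xAE; apply/eqP; rewrite -subr_eq0.
rewrite -(actB (F := F)) //; apply/eqP/xA_free.
by rewrite compBr [X in X - _](@comp_assoc C) -lE mE aSE subrr.
Qed.

Variables (L : wge_cat w) (x : pure_presheaf L).
Hypothesis xU : universal_element x.

Lemma pure_universal_right_orthogonal : right_orthogonal w (sval L).
Proof.
move=> E f wE; pose E1 : wge_cat w := exist _ (shift E) (w_ge_shift1 wE).
have [g [_ gU]] := xU (0 : pure_presheaf E1).
have act_eq0 (u : @hom (wge_cat w) E1 L) : act pure_presheaf u x = 0.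
  apply: ev_inj => Q b.
  by rewrite (w_le_ge_eq0 b (svalP Q).1 wE) !ev0b.
by have := gU f (act_eq0 f); rewrite (gU 0 (act_eq0 0)).
Qed.

Lemma pure_universal_heart (Q : w_heart w) (y : F Q) :
  exists! b : hom (sval Q) (sval L), ev x b = y.
Proof.
pose Q1 : wge_cat w := exist _ (sval Q) (svalP Q).2.
have ev_q (z : G0 Q1) (R : w_heart w) (b : hom (sval R) (sval Q1)) :
    ev z b = act F (b : @hom (w_heart w) R Q) (ev z (idm (sval Q))).
  by rewrite -ev_comp comp_idl.
have [|z zE] := @ev_exists Q1 (act F (a Q1 : @hom (w_heart w) (A Q1) Q) y).
  move=> R r r0; rewrite -act_comp.
  by rewrite [X in act F X]r0 act0.
have zy : ev z (idm (sval Q)) = y.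
  have [l lE] := @heart_lift Q1 Q (idm (sval Q)).
  rewrite -lE zE -act_comp [X in act F X]lE.
  exact: (act_id (F := F)).
have [b [bz bU]] := xU z.
exists b; split=> [|c cy].
  by have := ev_act b x (idm (sval Q)); rewrite comp_idr bz zy.
apply: bU; apply: ev_inj => R e.
rewrite ev_act [RHS]ev_q zy -cy -ev_comp.
by [].
Qed.

End PurePresheaf.

Lemma presheaf_isomorphic (C : category) (F G : functor (opcat C) Ab)
    (u : forall X, {additive F X -> G X}) :
  (forall (X Y : C) (f : hom X Y) (y : F Y),
     u X (act F f y) = act G f (u Y y)) ->
  (forall X (z : G X), exists! y, u X y = z) ->
  @isomorphic (functor_cat (opcat C) Ab) F G.
Proof.
move=> u_nat u_bij.
have /dependent_choice[v0 v0E] : forall X, exists v : {additive G X -> F X},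
    forall y z, u X y = z <-> v z = y.
  move=> X; have /dependent_choice[v vE] := u_bij X.
  have uv y z : u X y = z <-> v z = y.
    by split=> [|<-]; [apply: (vE z).2 | apply: (vE z).1].
  have v_nmod : nmod_morphism v.
    split=> [|y z]; apply/uv; rewrite ?raddf0 //.
    by rewrite raddfD; congr (_ + _); apply/uv.
  pose vA : {additive G X -> F X} :=
    HB.pack (v : G X -> F X) (GRing.isNmodMorphism.Build (G X) (F X) v v_nmod).
  by exists vA.
have na (X Y : opcat C) (f : hom X Y) : @comp Ab _ _ _ (u Y) (fmap F f) =
    @comp Ab _ _ _ (fmap G f) (u X).
  by apply: additiveP => y; apply: u_nat.
have nb (X Y : opcat C) (f : hom X Y) : @comp Ab _ _ _ (v0 Y) (fmap G f) =
    @comp Ab _ _ _ (fmap F f) (v0 X).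
  apply: additiveP => z; apply/v0E; rewrite [LHS]u_nat /act.
  by congr (ab_map _ _); apply/v0E.
exists (@NatTrans (opcat C) Ab F G u na), (@NatTrans (opcat C) Ab G F v0 nb).
by split; apply: nattransP => X; apply: additiveP => y /=; apply/v0E.
Qed.

Section PostComposition.
Variables (C : preadditive) (X M N : C) (f : hom M N).

Definition postcomp (g : phom X M) : phom X N := pcomp f g.

Lemma postcomp_nmod_morphism : nmod_morphism postcomp.
Proof. by split=> [|g g']; [apply: comp0r | apply: compDr]. Qed.

HB.instance Definition _ :=
  GRing.isNmodMorphism.Build (phom X M) (phom X N) postcomp
    postcomp_nmod_morphism.

End PostComposition.

Section HeartEquivalence.
Variables (C : triangulated) (w : weight_structure C) (t : t_structure C).
Hypothesis tw : right_adjacent t w.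
Hypothesis hcoprod : has_coproducts C.

Notation heart_restriction := (restriction (fun X : C => w_le w X /\ w_ge w X)).

Lemma w_heart_coproduct_closed :
  coproduct_closed (fun X : C => w_le w X /\ w_ge w X).
Proof.
move=> I X S inj cS wX; split.
  by apply: w_le_coproduct cS _ => i; case: (wX i).
by apply: (right_adjacent_coproduct_closed tw cS) => i; case: (wX i).
Qed.

Definition heart_presheaf (N : C) : product_respecting_presheaves (w_heart w).
Proof.
exists (heart_restriction (representable_presheaf N)); split.
  exact/restriction_additive/representable_additive.
apply: restriction_products => //; first exact: w_heart_coproduct_closed.
exact: representable_products.
Defined.

Definition heart_presheaf_map (M N : C) (f : hom M N) :
  hom (heart_presheaf M) (heart_presheaf N).
Proof.
apply: (@NatTrans (opcat (w_heart w)) Ab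
  (heart_restriction (representable_presheaf M))
  (heart_restriction (representable_presheaf N))
  (fun Q : w_heart w =>
     (postcomp f : {additive phom (sval Q) M -> phom (sval Q) N}))).
by move=> Q R g; apply: additiveP => h /=; apply: pcomp_assoc.
Defined.

Definition heart_functor :
  functor (t_heart t) (product_respecting_presheaves (w_heart w)).
Proof.
apply: (@Functor (t_heart t) _ (fun N => heart_presheaf (sval N))
  (fun M N f => heart_presheaf_map f)).
- move=> N; apply: nattransP => Q; apply: additiveP => h /=; exact: pcomp_idl.
- move=> X Y Z g f; apply: nattransP => Q; apply: additiveP => h /=.
  exact: esym (pcomp_assoc _ _ _).
Defined.

Lemma t_heart_right_orthogonal (N : t_heart t) : right_orthogonal w (sval N).
Proof. exact/(t_geE tw)/(svalP N).2. Qed.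

Lemma t_heart_w_ge (N : t_heart t) : w_ge w (sval N).
Proof. exact/tw/(svalP N).1. Qed.

Lemma heart_functor_faithful : faithful heart_functor.
Proof.
move=> M N f g fg.
have [A [K [k [a [d kad]]]]] :=
  heart_presentation (exist _ (sval M) (t_heart_w_ge M) : wge_cat w).
have /(congr1 (fun h : {additive phom (sval A) (sval M) ->
    phom (sval A) (sval N)} => h a)) :=
  congr1 (fun n : @nattrans (opcat (w_heart w)) Ab _ _ => n A) fg.
rewrite /= /postcomp => fga.
have [|v vE] := dist_weak_cokernel (dist_rot kad)
    (u := (f : hom (sval M) (sval N)) - (g : hom (sval M) (sval N))).
  by rewrite compBl [X in X - _]fga subrr.
apply/eqP; rewrite -subr_eq0; apply/eqP; rewrite [LHS]vE.
by rewrite (t_heart_right_orthogonal v (svalP K)) comp0l.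
Qed.

Lemma heart_functor_full : full heart_functor.
Proof.
move=> M N theta.
have thetaN (Q R : w_heart w) (c : hom (sval R) (sval Q))
    (b : hom (sval Q) (sval M)) :
    ab_map (ntmap theta R) (b \oc c) =
      (ab_map (ntmap theta Q) b : hom (sval Q) (sval N)) \oc c.
  by have /(congr1 (fun h : {additive phom (sval Q) (sval M) ->
    phom (sval R) (sval N)} => h b)) :=
    nt_natural theta (c : @hom (opcat (w_heart w)) Q R).
have [A [K [k [a [d kad]]]]] :=
  heart_presentation (exist _ (sval M) (t_heart_w_ge M) : wge_cat w).
have [A' [K' [k' [a' [d' kad']]]]] := heart_presentation K.
pose x : hom (sval A) (sval N) := ab_map (ntmap theta A) a.
have xk0 : x \oc k = 0.
  have [|v ->] := dist_weak_cokernel (dist_rot kad') (u := x \oc k).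
    rewrite -comp_assoc /x -thetaN comp_assoc (dist_comp0 kad) comp0l.
    exact: raddf0.
  by rewrite (t_heart_right_orthogonal v (svalP K')) comp0l.
have [f xf] := dist_weak_cokernel kad xk0.
exists f; apply: nattransP => Q; apply: additiveP => b.
have [|l ->] := dist_weak_kernel (dist_rot kad) (u := b).
  exact: (w_le_ge_eq0 _ (svalP Q).1 (svalP K)).
have := thetaN A Q l a; rewrite -/x xf => tE.
by apply: etrans (esym tE); apply: (@pcomp_assoc C).
Qed.

Lemma heart_functor_ess_surj :
  brown_representability C -> ess_surj heart_functor.
Proof.
move=> hbrown [F [Fadd Fprod]].
have wsm := right_adjacent_coproduct_closed tw.
have /dependent_choice[A /dependent_choice[K /dependent_choice[k
  /dependent_choice[a /dependent_choice[d kad]]]]] := @heart_presentation C w.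
have /dependent_choice[G0 /dependent_choice[iota iotaE]] : forall B : wge_cat w,
    exists (G0 : zmodType), exists i : {additive G0 -> F (A B)},
    injective i /\ forall x, relation_free a x <-> exists y, i y = x.
  move=> B; apply: subgroup_exists; first exact: relation_free0.
  exact: relation_freeB.
have iota_inj B := (iotaE B).1; have iota_im B := (iotaE B).2.
pose G := pure_presheaf Fadd kad iota_inj iota_im.
have [|||L [x xU]] := @relative_brown_representability C w G hcoprod hbrown wsm.
- exact: pure_presheaf_additive.
- exact: pure_presheaf_products.
- exact: pure_presheaf_exact.
have tL : t_le t (sval L) /\ t_ge t (sval L).
  split; first exact/tw/svalP.
  exact/(t_geE tw)/(pure_universal_right_orthogonal xU).
exists (exist _ (sval L) tL).
pose e (Q : w_heart w) (b : phom (sval Q) (sval L)) : F Q := ev kad iota x b.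
have e_nmod Q : nmod_morphism (e Q).
  by split=> [|b c]; [apply: ev0b | apply: evDb].
pose eA Q : {additive phom (sval Q) (sval L) -> F Q} :=
  HB.pack (e Q) (GRing.isNmodMorphism.Build _ _ (e Q) (e_nmod Q)).
apply: (@presheaf_isomorphic _
  (heart_restriction (representable_presheaf (sval L))) F eA).
  by move=> Q R f b; apply: ev_comp.
by move=> Q y; apply: (pure_universal_heart xU).
Qed.

End HeartEquivalence.

Theorem theorem0p1 (C : triangulated) (hcoprod : has_coproducts C)
  (hbrown : brown_representability C) (w : weight_structure C) :
  ((exists t : t_structure C, right_adjacent t w) <-> smashing w) /\
  (forall t : t_structure C, right_adjacent t w ->
     equivalent (t_heart t) (product_respecting_presheaves (w_heart w))).
Proof.
split=> [|t tw].
  split=> [[t tw]|[_ wsm]]; last exact: adjacent_t_structure_exists.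
  by split=> //; apply: right_adjacent_coproduct_closed tw.
exists (heart_functor tw hcoprod); apply: fully_faithful_equivalence.
- exact: heart_functor_faithful.
- exact: heart_functor_full.
- exact: heart_functor_ess_surj.
Qed.
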